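(* Let $K$ be a field, let $\epsilon$ be a nonnegative integer, and let $M,N:\mathbb{Z}\to\mathrm{vect}_K$ be persistence modules. There is a bijective correspondence between the collection of essential $\epsilon$-matchings $\sigma:B(M)\to B(N)$ and the set of isomorphism classes of interval-decomposable representations $L$ of $\Sigma_\epsilon\mathbb{Z}$ such that $L|_{\mathrm{left}}\cong M$ and $L|_{\mathrm{right}}\cong N$.
   Context: $\mathrm{vect}_K$ is the category of finite-dimensional $K$-vector spaces. A preordered set (proset) is viewed as a category with a unique morphism $x\to y$ (denoted $x\leq y$) exactly when $x\leq y$. A representation of a proset $P$ is a functor $P\to\mathrm{vect}_K$; morphisms are natural transformations. A persistence module here is a representation of $(\mathbb{Z},\leq)$. Shoelace: $\Sigma_\epsilon\mathbb{Z}$ is the proset with underlying set $\mathbb{Z}\sqcup\mathbb{Z}'=\{i\}_{i\in\mathbb{Z}}\sqcup\{i'\}_{i\in\mathbb{Z}}$ and, for $i,j\in\mathbb{Z}$: $i\leq j$ in $\Sigma_\epsilon\mathbb{Z}$ iff $i'\leq j'$ iff $i\leq j$ in $\mathbb{Z}$; $i\leq j'$ iff $i'\leq j$ iff $i+\epsilon\leq j$ in $\mathbb{Z}$. For a representation $L$ of $\Sigma_\epsilon\mathbb{Z}$, $L|_{\mathrm{left}}$ is its restriction to the copy $\mathbb{Z}$ and $L|_{\mathrm{right}}$ its restriction to the copy $\mathbb{Z}'$ (regarded as a representation of $\mathbb{Z}$ via $i\leftrightarrow i'$). Intervals: a subset $S$ of $P$ (with induced order) is connected if whenever $S=S_1\sqcup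 S_2$ with no element of $S_1$ comparable to an element of $S_2$, then $S_1=\emptyset$ or $S_2=\emptyset$; it is convex if $s,t\in S$, $s\leq x\leq t$ imply $x\in S$; it is an interval if connected and convex. A representation $M$ of $P$ is an interval representation if $\dim M(x)\leq1$ for all $x\in P$, its support $S=\{x: M(x)\neq0\}$ is an interval, and $M(x)=K$ for $x\in S$ with $M(x\leq y)=1$ for all $x\leq y$ in $S$. A representation is interval-decomposable if it is isomorphic to a direct sum of interval representations. Barcodes: every persistence module $\mathbb{Z}\to\mathrm{vect}_K$ is a direct sum of interval representations $I[x,y]$, with support $\{a\in\mathbb{Z}:x\leq a\leq y\}\neq\emptyset$, where $x\in\mathbb{Z}\cup\{-\infty\}$, $y\in\mathbb{Z}\cup\{\infty\}$ (when an endpoint is infinite these are the intervals $I(-\infty,y]$, $I[x,\infty)$, $I(-\infty,\infty)$). $B(M)$ is the multiset of isomorphism classes of (nonzero) interval summands in such a decomposition of $M$. Conventions for endpoints: $|\pm\infty-(\mp\infty)|=\infty$, $|\pm\infty-(\pm\infty)|=0$, $|\pm\infty-x|=|x-(\pm\infty)|=\infty$ for $x\in\mathbb{Z}$. Matchings: a matching $\sigma:B(M)\to B(N)$ is a bijection between submultisets of $B(M)$ and $B(N)$ (as a matching of multisets, i.e. equal copies of the same interval are not distinguished: it is determined by the number of times each pair $(I,J)$ is matched). It is an $\epsilon$-matching if (1) $\sigma(I[x,y])=I[s,t]$ implies $|x-s|\leq\epsilon$ and $|y-t|\leq\epsilon$; and (2) if an interval $I[x,y]$ (in $B(M)$ or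 $B(N)$) is unmatched, then $|x-y|<2\epsilon$. An $\epsilon$-matching is essential if for every matched pair $\sigma(I[x,y])=I[s,t]$ with $|y-x|<2\epsilon$ and $|t-s|<2\epsilon$ one has $$s-\epsilon\leq x\leq t-\epsilon\leq y\quad\text{or}\quad x-\epsilon\leq s\leq y-\epsilon\leq t.$$ *)

(* Defs.v *)
From HB Require Import structures.
From mathcomp Require Import all_boot all_order all_algebra.
From mathcomp Require Import all_classical constructive_ereal.

Set Implicit Arguments.
Unset Strict Implicit.
Unset Printing Implicit Defensive.

Import Order.TTheory GRing.Theory Num.Theory.

Local Open Scope classical_set_scope.
Local Open Scope ring_scope.

Section Representations.
Context {K : fieldType} {d : Order.disp_t} {P : preorderType d}.

(* Functors P -> vect_K. As [(x <= y)%O] is a boolean, its proofs are unique. *)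
Record rep : Type := Rep {
  rep_obj :> P -> vectType K;
  rep_map : forall x y : P, (x <= y)%O -> 'Hom(rep_obj x, rep_obj y);
  rep_map_id : forall (x : P) (h : (x <= x)%O), rep_map h = \1%VF;
  rep_map_comp : forall (x y z : P) (hxy : (x <= y)%O) (hyz : (y <= z)%O)
    (hxz : (x <= z)%O), rep_map hxz = (rep_map hyz \o rep_map hxy)%VF }.

Record rep_hom (M N : rep) : Type := RepHom {
  hom_at :> forall x : P, 'Hom(M x, N x);
  hom_natural : forall (x y : P) (h : (x <= y)%O),
    (hom_at y \o rep_map M h)%VF = (rep_map N h \o hom_at x)%VF }.

Definition rep_iso (M N : rep) : Prop :=
  exists (f : rep_hom M N) (g : rep_hom N M), forall x : P,
    (g x \o f x)%VF = \1%VF /\ (f x \o g x)%VF = \1%VF.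

(* L is isomorphic to the pointwise direct sum of the V i. The index type may
   be infinite, so the direct sum of the V i x need not be a [vectType] a
   priori; its identification with L x, induced by the injections iota i, is
   expressed by existence and uniqueness of finitely supported
   decompositions. *)
Definition is_direct_sum (I : choiceType) (V : I -> rep) (L : rep) : Prop :=
  exists iota : forall i : I, rep_hom (V i) L,
    forall (x : P) (v : L x), exists! w : forall i : I, V i x,
      finite_set [set i | w i != 0] /\
      v = \sum_(i \in [set: I]) iota i x (w i).

Definition connected_subset (S : set P) : Prop :=
  forall S1 S2 : set P, S = S1 `|` S2 -> S1 `&` S2 = set0 ->
    (forall s1 s2 : P, S1 s1 -> S2 s2 -> ~ (s1 <= s2)%O /\ ~ (s2 <= s1)%O) ->
    S1 = set0 \/ S2 = set0.

Definition convex_subset (S : set P) : Prop :=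
  forall s x t : P, S s -> S t -> (s <= x)%O -> (x <= t)%O -> S x.

Definition interval_subset (S : set P) : Prop :=
  connected_subset S /\ convex_subset S.

Definition rep_support (M : rep) : set P := [set x | \dim {:M x} != 0%N].

(* The equalities M(x) = K are read as identifications e x : M x ~ K, under
   which all maps inside the support become the identity of K. *)
Definition interval_rep (M : rep) : Prop :=
  [/\ forall x : P, (\dim {:M x} <= 1)%N,
      interval_subset (rep_support M)
    & exists e : forall x : P, 'Hom(M x, K^o),
        (forall x : P, rep_support M x -> bijective (e x)) /\
        (forall (x y : P) (h : (x <= y)%O),
           rep_support M x -> rep_support M y ->
           (e y \o rep_map M h)%VF = e x)].

Definition interval_decomposable (L : rep) : Prop :=
  exists (I : choiceType) (V : I -> rep),
    (forall i : I, interval_rep (V i)) /\ is_direct_sum V L.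

End Representations.

Arguments rep K {d} P.

Section Restriction.
Context {K : fieldType} {d d' : Order.disp_t}.
Context {P : preorderType d} {Q : preorderType d'}.
Variables (f : P -> Q) (f_mono : forall x y : P, (x <= y)%O -> (f x <= f y)%O).
Variable L : rep K Q.

Lemma restrict_id (x : P) (h : (x <= x)%O) :
  rep_map L (f_mono h) = \1%VF.
Proof. exact: rep_map_id. Qed.

Lemma restrict_comp (x y z : P) (hxy : (x <= y)%O) (hyz : (y <= z)%O)
    (hxz : (x <= z)%O) :
  rep_map L (f_mono hxz) = (rep_map L (f_mono hyz) \o rep_map L (f_mono hxy))%VF.
Proof. exact: rep_map_comp. Qed.

Definition restrict : rep K P :=
  @Rep K d P (fun x => L (f x)) (fun x y h => rep_map L (f_mono h))
    restrict_id restrict_comp.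

End Restriction.

(* [inl i] is the element i, and [inr i] is the element i'. *)
Definition shoelace (eps : nat) : Type := (int + int)%type.

Definition shoelace_le (eps : nat) : rel (shoelace eps) := fun p q =>
  match p, q with
  | inl i, inl j | inr i, inr j => i <= j
  | inl i, inr j | inr i, inl j => i + eps%:Z <= j
  end.

Fact shoelace_display : Order.disp_t. Proof. exact: Order.Disp tt tt. Qed.

Section Shoelace.
Variable eps : nat.

Lemma shoelace_le_refl : reflexive (@shoelace_le eps).
Proof. by case=> i /=. Qed.

Lemma shoelace_le_trans : transitive (@shoelace_le eps).
Proof.
have e0 : 0 <= eps%:Z by [].
have mono (a b c : int) : a <= b -> b + eps%:Z <= c -> a + eps%:Z <= c.
  by move=> ab; apply: le_trans; rewrite lerD2r.
have mono' (a b c : int) : a + eps%:Z <= b -> b <= c -> a + eps%:Z <= c.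
  by move=> ab; apply: le_trans.
have skip (a b c : int) : a + eps%:Z <= b -> b + eps%:Z <= c -> a <= c.
  move=> ab bc; rewrite (le_trans _ (mono' _ _ _ ab (le_trans _ bc))) //.
    by rewrite lerDl.
  by rewrite lerDl.
case=> j [i|i] [k|k] /=; first [exact: le_trans | exact: mono | exact: mono' | exact: skip].
Qed.

HB.instance Definition _ := Choice.on (shoelace eps).
HB.instance Definition _ := Order.Le_isPreorder.Build shoelace_display
  (shoelace eps) shoelace_le_refl shoelace_le_trans.

Definition shoelace_l (i : int) : shoelace eps := inl i.
Definition shoelace_r (i : int) : shoelace eps := inr i.

Lemma shoelace_l_mono (i j : int) :
  (i <= j)%O -> (shoelace_l i <= shoelace_l j)%O.
Proof. by []. Qed.

Lemma shoelace_r_mono (i j : int) :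
  (i <= j)%O -> (shoelace_r i <= shoelace_r j)%O.
Proof. by []. Qed.

End Shoelace.

Definition persistence_module (K : fieldType) : Type := rep K int.

Definition restrict_left (K : fieldType) (eps : nat)
  (L : rep K (shoelace eps)) : persistence_module K :=
  restrict (@shoelace_l_mono eps) L.

Definition restrict_right (K : fieldType) (eps : nat)
  (L : rep K (shoelace eps)) : persistence_module K :=
  restrict (@shoelace_r_mono eps) L.

(* The nonempty intervals I[x,y] of Z, given by their endpoints x, y, with
   x in Z u {-oo} and y in Z u {+oo}; nonemptiness amounts to x <= y. *)
Definition bar : Type :=
  {p : \bar int * \bar int |
    [&& p.1 != +oo%E, p.2 != -oo%E & (p.1 <= p.2)%E]}.
HB.instance Definition _ := Choice.on bar.

Definition bar_lo (I : bar) : \bar int := (val I).1.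
Definition bar_hi (I : bar) : \bar int := (val I).2.
Definition bar_set (I : bar) : set int :=
  [set a | (bar_lo I <= a%:E)%E && (a%:E <= bar_hi I)%E].

(* Multisets of intervals are multiplicity functions. *)
Definition bar_multiset : Type := bar -> nat.

Definition is_barcode (K : fieldType) (M : persistence_module K)
    (B : bar_multiset) : Prop :=
  exists V : {I : bar & 'I_(B I)} -> persistence_module K,
    (forall c, interval_rep (V c) /\ rep_support (V c) = bar_set (tag c)) /\
    is_direct_sum V M.

(* A multiset of intervals decomposing M always exists and is unique; the
   default value (the empty multiset) is never used. *)
Definition barcode (K : fieldType) (M : persistence_module K) : bar_multiset :=
  xget (fun=> 0%N) [set B | is_barcode M B].

(* |x - y| with the conventions for infinite endpoints; ereal subtraction
   would give the value +oo to |+oo - +oo|. *)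
Definition endpoint_dist (x y : \bar int) : \bar int :=
  match x, y with
  | a%:E, b%:E => (`|a - b|)%:E
  | +oo, +oo | -oo, -oo => 0
  | _, _ => +oo
  end%E.

Definition bar_short (eps : nat) (I : bar) : Prop :=
  (endpoint_dist (bar_lo I) (bar_hi I) < ((2 * eps)%N%:Z)%:E)%E.

(* A bijection between submultisets of B and B' is encoded by the number
   [m I J] of copies of the pair (I, J) that are matched; the matched
   submultisets are its two marginals. *)
Definition pair_multiset : Type := bar -> bar -> nat.

Definition matched_l (m : pair_multiset) : bar_multiset :=
  fun I => \big[addn/0%N]_(J \in [set: bar]) m I J.
Definition matched_r (m : pair_multiset) : bar_multiset :=
  fun J => \big[addn/0%N]_(I \in [set: bar]) m I J.

(* The finiteness conditions are needed since a [\big_(_ \in _)] with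
   infinite support is 0 by convention. *)
Definition is_matching (B B' : bar_multiset) (m : pair_multiset) : Prop :=
  [/\ forall I, finite_set [set J | m I J != 0%N],
      forall J, finite_set [set I | m I J != 0%N],
      forall I, (matched_l m I <= B I)%N
    & forall J, (matched_r m J <= B' J)%N].

Definition is_eps_matching (eps : nat) (B B' : bar_multiset)
    (m : pair_multiset) : Prop :=
  [/\ is_matching B B' m,
      forall I J, (0 < m I J)%N ->
        (endpoint_dist (bar_lo I) (bar_lo J) <= (eps%:Z)%:E)%E /\
        (endpoint_dist (bar_hi I) (bar_hi J) <= (eps%:Z)%:E)%E,
      forall I, (matched_l m I < B I)%N -> bar_short eps I
    & forall J, (matched_r m J < B' J)%N -> bar_short eps J].

Definition is_essential (eps : nat) (m : pair_multiset) : Prop :=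
  forall I J, (0 < m I J)%N -> bar_short eps I -> bar_short eps J ->
    let: x := bar_lo I in let: y := bar_hi I in
    let: s := bar_lo J in let: t := bar_hi J in
    let: e := ((eps%:Z)%:E)%E in
    [/\ s - e <= x, x <= t - e & t - e <= y]%E \/
    [/\ x - e <= s, s <= y - e & y - e <= t]%E.

Definition essential_eps_matchings (eps : nat) (B B' : bar_multiset) :
    set pair_multiset :=
  [set m | is_eps_matching eps B B' m /\ is_essential eps m].

(* The representations whose isomorphism classes are counted. *)
Definition connects (K : fieldType) (eps : nat) (M N : persistence_module K)
    (L : rep K (shoelace eps)) : Prop :=
  [/\ interval_decomposable L,
      rep_iso (restrict_left L) M & rep_iso (restrict_right L) N].

(* The set of R-classes of elements of A is in bijection with B: the bijection
   is given by a function on A that is well defined and injective on R-classes.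
   (A type of classes T -> Prop with the library's [set_bij] is not available
   for T := rep K P, which lives in a universe too large for [set].) *)
Definition classes_in_bijection (T : Type) (A : T -> Prop) (R : T -> T -> Prop)
    (U : Type) (B : U -> Prop) : Prop :=
  exists f : T -> U,
    [/\ forall t, A t -> B (f t),
        forall t t', A t -> A t' -> (R t t' <-> f t = f t')
      & forall u, B u -> exists t, A t /\ f t = u].

(* Main.v *)
From HB Require Import structures.
Require Import Defs.
From mathcomp Require Import all_boot all_order all_algebra all_classical.
From mathcomp Require Import constructive_ereal zify.

(** An interval-decomposable representation of the shoelace is determined by
    the multiplicities of its interval summands, and the intervals of the
    shoelace can be listed: each copy of Z meets such an interval in the empty
    set or in one bar.

    A bar of one copy alone is convex in the shoelace iff it has length less
    than 2 eps, since a detour through the other copy costs 2 eps; this is the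
    condition on the unmatched bars. A bar I on the left together with a bar J
    on the right is convex iff the corresponding endpoints are eps-close, and
    it is connected iff some element of one bar lies below an element of the
    other. The latter is the condition defining essential matchings, and for
    eps-close bars it holds as soon as one of them has length at least 2 eps
    ([compatible_of_interval], [interval_of_compatible],
    [compatible_of_essential]).

    So let m be the multiplicity function of L, where a pair of optional bars
    stands for an interval of the shoelace. The multiplicities of the pairs
    (I, J) form an essential matching. Counting the summands of the restriction
    of L to the left copy gives that B(M) takes at I the value
    m (I, no bar) + sum over J of m (I, J), and symmetrically for B(N). Hence
    the numbers m (I, J) determine m, thus L; and from an essential matching
    these equations define a function m, which is the multiplicity function of
    some L because only finitely many of the intervals contain a given point.

    This relies on two facts on decompositions, the uniqueness of multiplicities
    ([decomposes_unique]) and the existence of barcodes ([decomposes_barcode]).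
    Both are proved with threads. A morphism from the interval representation
    with support S to L is given by the images v p of 1 for p in S; injectivity
    at each point of S makes it a family v such that the structure map from p to
    q sends v p to v q whenever v p is nonzero. A decomposition of L
    into intervals is a family of threads with connected supports whose nonzero
    members form a basis of L p at every p ([direct_sum_thread_rep] and
    [thread_basis_of_direct_sum]).

    For uniqueness, two such bases are compared at a point of an interval S
    by transition matrices. A thread contributes to the composite of two threads
    with support S only if its own support is S ([thread_supp_eq]), so the
    blocks of the transition matrices indexed by the threads with support S are
    inverse to each other, and have the same number of rows and columns.

    For existence, the space M k carries the chain of the images of the maps
    from the left and the chain of the kernels of the maps to the right. Two
    chains of subspaces have a common adapted basis ([adapted_chains]), and
    an adapted basis at k can be continued to adapted bases at k + 1 and at
    k - 1 in such a way that the structure maps send basis vectors to basis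
    vectors or to 0 ([adapted_basis_right], [adapted_basis_left]). The threads
    are the classes of basis vectors connected by the structure maps. *)

Set Implicit Arguments.
Unset Strict Implicit.
Unset Printing Implicit Defensive.

Import Order.TTheory GRing.Theory Num.Theory.

Local Open Scope classical_set_scope.
Local Open Scope ring_scope.

(** * Threads and thread bases *)
Section ThreadBases.
Context {K : fieldType} {d : Order.disp_t} {P : preorderType d}.
Implicit Types (L : rep K P) (I : choiceType).

Definition is_thread L (v : forall p, L p) : Prop :=
  forall (p q : P) (h : (p <= q)%O), v p != 0 -> rep_map L h (v p) = v q.

Definition thread_supp L (v : forall p, L p) : set P := [set p | v p != 0].

(** The list s makes the finiteness of the family at p part of the definition;
    threads that vanish at p are allowed, so that one index type serves all
    points, and also the restrictions of L along monotone maps. *)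
Definition thread_basis L I (v : I -> forall p, L p) : Prop :=
  (forall i, is_thread (v i)) /\
  forall p, exists s : seq I,
    [/\ uniq s, forall i, (i \in s) = (v i p != 0)
      & basis_of {:L p} [seq v i p | i <- s]].

Lemma rep_mapE L (p q r : P) (pq : (p <= q)%O) (qr : (q <= r)%O)
    (pr : (p <= r)%O) (x : L p) :
  rep_map L pr x = rep_map L qr (rep_map L pq x).
Proof. by rewrite (rep_map_comp L pq qr) comp_lfunE. Qed.

Lemma rep_map1 L (p : P) (pp : (p <= p)%O) (x : L p) : rep_map L pp x = x.
Proof. by rewrite rep_map_id id_lfunE. Qed.

Lemma convex_thread_supp L (v : forall p, L p) :
  is_thread v -> convex_subset (thread_supp v).
Proof.
move=> vT p q r /= vp vr pq qr; apply: contra_neq vr => vq.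
by rewrite -(vT _ _ (le_trans pq qr) vp) (rep_mapE pq qr) vT // vq linear0.
Qed.

Lemma hom_naturalE (L L' : rep K P) (f : rep_hom L L') (p q : P)
    (h : (p <= q)%O) (x : L p) : f q (rep_map L h x) = rep_map L' h (f p x).
Proof. by have /lfunP/(_ x) := hom_natural f h; rewrite !comp_lfunE. Qed.

Lemma basis_lfun (V W : vectType K) I (v : I -> V) (u : I -> W) (s : seq I) :
    uniq s -> basis_of {:V} [seq v i | i <- s] ->
  exists g : 'Hom(V, W), forall i, i \in s -> g (v i) = u i.
Proof.
move=> s_uniq /basis_free fr.
have [g /(_ fr)] := linear_of_free [seq v i | i <- s] [seq u i | i <- s].
rewrite !size_map => /(_ erefl) eg; exists (linfun g) => i si.
rewrite lfunE /=.
have lt : (index i s < size s)%N by rewrite index_mem.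
have := congr1 (nth 0 ^~ (index i s)) eg.
by rewrite -map_comp !(nth_map i) //= nth_index.
Qed.

Lemma free_map (V : vectType K) I (v : I -> V) (s : seq I) : uniq s ->
    (forall c : I -> K, \sum_(i <- s) c i *: v i = 0 ->
      forall i, i \in s -> c i = 0) ->
  free [seq v i | i <- s].
Proof.
elim: s => [|i s IH] /=; first by rewrite nil_free.
move=> /andP[i_s s_uniq] c0; rewrite free_cons.
have fr : free [seq v j | j <- s].
  apply: IH => // c sum0 j js.
  have ji : j != i by apply: contraNneq i_s => <-.
  have := c0 (fun k => if k == i then 0 else c k).
  rewrite big_cons eqxx scale0r add0r (eq_big_seq (fun k => c k *: v k)).
    by move=> /(_ sum0 j); rewrite inE js orbT (negbTE ji); apply.
  by move=> k ks; rewrite ifN //; apply: contraNneq i_s => <-.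
rewrite fr andbT; apply/negP => /(free_span fr)[a vE _].
have := c0 (fun k => if k == i then -1 else a (v k)).
rewrite big_cons eqxx scaleN1r (eq_big_seq (fun k => a (v k) *: v k)).
  rewrite -(big_map v xpredT (fun x => a x *: x)) -vE addNr.
  by move=> /(_ erefl i); rewrite inE eqxx => /(_ erefl)/eqP; rewrite oppr_eq0 oner_eq0.
by move=> k ks; rewrite ifN //; apply: contraNneq i_s => <-.
Qed.

Lemma basis_coord (V : vectType K) I (v : I -> V) (s : seq I) :
    uniq s -> basis_of {:V} [seq v i | i <- s] ->
  exists c : I -> 'Hom(V, K^o),
    (forall i k, k \in s -> c i (v k) = (k == i)%:R) /\
    forall x, x = \sum_(i <- s) c i x *: v i.
Proof.
move=> s_uniq sB.
have ex i := @basis_lfun V K^o I v (fun k => (k == i)%:R) s s_uniq sB.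
pose c i := sval (cid (ex i)).
have cE i k : k \in s -> c i (v k) = (k == i)%:R.
  by rewrite /c; case: cid => f fE /=; apply: fE.
exists c; split=> // x.
have /(free_span (basis_free sB))[a xE _] : x \in <<[seq v i | i <- s]>>%VS.
  by rewrite (span_basis sB) memvf.
rewrite {1}xE big_map; apply: eq_big_seq => k ks; congr (_ *: _).
rewrite xE big_map linear_sum (bigD1_seq k) //= linearZ /= cE // eqxx.
rewrite big_seq_cond big1 => [|i /andP[i_s ik]].
  by rewrite addr0 /GRing.scale /= mulr1.
by rewrite linearZ /= cE // (negbTE ik) scaler0.
Qed.

Section OneBasis.
Variables (L : rep K P) (I : choiceType) (v : I -> forall p, L p).
Hypothesis vB : thread_basis v.

Lemma thread_basis_lfun p (W : vectType K) (u : I -> W) :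
    (forall i, v i p = 0 -> u i = 0) ->
  exists g : 'Hom(L p, W), forall i, g (v i p) = u i.
Proof.
move=> u0; have [s [s_uniq sE sB]] := vB.2 p.
have [g gE] := @basis_lfun _ _ _ (v^~ p) u s s_uniq sB.
exists g => i; have [is_|] := boolP (i \in s); first exact: gE.
by rewrite sE negbK => /eqP vi; rewrite vi linear0 u0.
Qed.

Lemma thread_basis_eq p (W : vectType K) (f g : 'Hom(L p, W)) :
  (forall i, v i p != 0 -> f (v i p) = g (v i p)) -> f = g.
Proof.
move=> fg; have [s [s_uniq sE sB]] := vB.2 p.
apply/(fullv_lfunP _ _ (span_basis sB)) => _ /mapP[i si ->].
by apply: fg; rewrite -sE.
Qed.

(** Morphisms out of a direct sum of interval representations are prescribed
    freely on the generators: u i is the image of the thread v i, and has to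
    die where v i dies. *)
Lemma thread_basis_hom L' (u : I -> forall p, L' p) :
    (forall i p, v i p = 0 -> u i p = 0) ->
    (forall i p q (h : (p <= q)%O), v i p != 0 ->
      rep_map L' h (u i p) = u i q) ->
  exists f : rep_hom L L', forall i p, f p (v i p) = u i p.
Proof.
move=> u0 uT.
pose F p := cid (@thread_basis_lfun p _ (u^~ p) (u0^~ p)).
have FE p i : sval (F p) (v i p) = u i p by case: (F p).
have nat p q (h : (p <= q)%O) :
    (sval (F q) \o rep_map L h)%VF = (rep_map L' h \o sval (F p))%VF.
  apply: thread_basis_eq => i vi.
  by rewrite !comp_lfunE vB.1 // !FE uT.
by exists (@RepHom _ _ _ L L' (fun p => sval (F p)) nat).
Qed.

(** Only the threads that are somewhere nonzero matter, so the index type may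
    be replaced by any copy of the set of these. *)
Lemma thread_basis_reindex (J : choiceType) (g : J -> I) :
    injective g -> (forall i p, v i p != 0 -> exists j, g j = i) ->
  thread_basis (fun j => v (g j)).
Proof.
move=> g_inj g_surj; split=> [j|p]; first exact: vB.1.
have [s [s_uniq sE sB]] := vB.2 p.
have [t tE] : exists t : seq J, map g t = s.
  have : {subset s <= s} by [].
  elim: {1 3}s => [|i r IH] sub; first by exists [::].
  have [|t <-] := IH; first by move=> k kr; apply: sub; rewrite inE kr orbT.
  have [|j <-] := g_surj i p; first by rewrite -sE sub // inE eqxx.
  by exists (j :: t).
exists t; split.
- by rewrite -tE in s_uniq; exact: map_uniq s_uniq.
- by move=> j; rewrite -sE -tE mem_map.
- by rewrite -tE -map_comp in sB.
Qed.

End OneBasis.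

Lemma thread_basis_iso L L' I (v : I -> forall p, L p)
    (v' : I -> forall p, L' p) :
    thread_basis v -> thread_basis v' ->
    (forall i p, v i p = 0 <-> v' i p = 0) ->
  rep_iso L L'.
Proof.
move=> vB vB' vv'.
have [|i p q h vi|f fE] := thread_basis_hom vB (u := v').
- by move=> i p /vv'.
- by apply: vB'.1; apply: contra_neq vi => /vv'.
have [|i p q h vi|g gE] := thread_basis_hom vB' (u := v).
- by move=> i p /vv'.
- by apply: vB.1; apply: contra_neq vi => /vv'.
exists f, g => p; split.
- by apply: (thread_basis_eq vB) => i _; rewrite comp_lfunE id_lfunE fE gE.
- by apply: (thread_basis_eq vB') => i _; rewrite comp_lfunE id_lfunE gE fE.
Qed.

Lemma thread_basis_transport L L' I (v : I -> forall p, L p) :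
    thread_basis v -> rep_iso L L' ->
  exists v' : I -> forall p, L' p,
    thread_basis v' /\ forall i p, v i p = 0 <-> v' i p = 0.
Proof.
move=> vB [f [g fg]]; exists (fun i p => f p (v i p)).
have fK p x : g p (f p x) = x.
  by have /lfunP/(_ x) := (fg p).1; rewrite comp_lfunE id_lfunE.
have gK p x : f p (g p x) = x.
  by have /lfunP/(_ x) := (fg p).2; rewrite comp_lfunE id_lfunE.
have f0 p x : (f p x == 0) = (x == 0).
  by apply/eqP/eqP => [fx|->]; rewrite ?linear0// -(fK p x) fx linear0.
split; last by move=> i p; split=> /eqP fv; apply/eqP; rewrite f0 in fv *.
split=> [i p q h|p].
  by rewrite f0 => vi; rewrite -hom_naturalE vB.1.
have [s [s_uniq sE sB]] := vB.2 p; exists s; split=> // [i|].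
  by rewrite f0 sE.
have f_inj : lker (f p) = 0%VS by apply/eqP/lker0P; apply: can_inj (fK p).
have -> : {:L' p}%VS = limg (f p).
  apply/eqP; rewrite eq_sym eqEsubv subvf; apply/subvP => x _.
  by rewrite -(gK p x) memv_img // memvf.
rewrite (map_comp (f p)) limg_basis_of //.
by rewrite f_inj capv0.
Qed.

End ThreadBases.

(** * Thread bases and direct sums of interval representations *)

(** On a space of rows of length at most 1, the map that sends the generator
    to v. *)
Section ScaledRowSum.
Context {K : fieldType} {V : vectType K}.
Variables (n : nat) (v : V).

Definition row_sum (x : 'rV[K]_n) : V := (\sum_j x 0 j) *: v.

Lemma row_sum_is_linear : linear row_sum.
Proof.
move=> a x y; rewrite /row_sum scalerA -scalerDl; congr (_ *: _).
by rewrite mulr_sumr -big_split; apply: eq_bigr => j _; rewrite !mxE.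
Qed.

HB.instance Definition _ := GRing.isLinear.Build K 'rV[K]_n V _ row_sum
  row_sum_is_linear.

Definition row_sum_lfun : 'Hom('rV[K]_n, V) := linfun row_sum.

Lemma row_sum_lfunE x : row_sum_lfun x = (\sum_j x 0 j) *: v.
Proof. exact: lfunE. Qed.

End ScaledRowSum.

Lemma ord_bool_eq (b : bool) (i j : 'I_b) : i = j.
Proof. by case: b i j => [|[]//] i j; rewrite (ord1 i) (ord1 j). Qed.

Lemma ord_boolP (b : bool) (i : 'I_b) : b.
Proof. by case: b i => [|[]//]. Qed.

Section IntervalOfThread.
Context {K : fieldType} {d : Order.disp_t} {P : preorderType d}.
Variables (L : rep K P) (v : forall p, L p).
Hypothesis vT : is_thread v.

(* The fibre of the interval representation at p is the space of rows whose
   length is the truth value of v p != 0, of dimension 0 or 1. *)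
Let b (p : P) : bool := v p != 0.

Definition thread_rep_map (p q : P) (_ : (p <= q)%O) :
    'Hom('rV[K]_(b p), 'rV[K]_(b q)) :=
  linfun (mulmxr (const_mx 1)).

Lemma thread_rep_mapE p q (h : (p <= q)%O) (x : 'rV_(b p)) (j : 'I_(b q)) :
  thread_rep_map h x 0 j = \sum_i x 0 i.
Proof.
by rewrite lfunE /= mxE; apply: eq_bigr => i _; rewrite mxE mulr1.
Qed.

Lemma sum_ord_bool (c : bool) (F : 'I_c -> K) (i : 'I_c) : \sum_j F j = F i.
Proof.
rewrite (bigD1 i) //= big1 ?addr0 // => j.
by rewrite (ord_bool_eq j i) eqxx.
Qed.

Lemma thread_rep_map_id p (h : (p <= p)%O) : thread_rep_map h = \1%VF.
Proof.
apply/lfunP => x; apply/rowP => i.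
by rewrite thread_rep_mapE id_lfunE (sum_ord_bool _ i).
Qed.

(** Convexity of the support is what makes composition work: a composite through
    q is 0 when the fibre at q vanishes. *)
Lemma thread_rep_map_comp p q r (pq : (p <= q)%O) (qr : (q <= r)%O)
    (pr : (p <= r)%O) :
  thread_rep_map pr = (thread_rep_map qr \o thread_rep_map pq)%VF.
Proof.
apply/lfunP => x; apply/rowP => k; rewrite comp_lfunE !thread_rep_mapE.
have [vp|vp] := pselect (b p); last first.
  by rewrite !big1 // => [j _|i _]; [rewrite thread_rep_mapE big1 // => i _|];
    case: vp; exact: ord_boolP i.
have vr := ord_boolP k.
have vq : b q by apply: (convex_thread_supp vT) vp vr pq qr.
have iq : 'I_(b q) by rewrite vq; exact: ord0.
by rewrite (sum_ord_bool _ iq) thread_rep_mapE.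
Qed.

Definition thread_rep : rep K P :=
  Rep thread_rep_map_id thread_rep_map_comp.

Lemma dim_thread_rep p : \dim {:thread_rep p} = b p.
Proof. by rewrite dimvf /dim /= mul1n. Qed.

Lemma thread_rep_support : rep_support thread_rep = thread_supp v.
Proof.
apply/seteqP; split=> p; rewrite /rep_support /thread_supp /= dim_thread_rep /b.
  by case: (v p != 0).
by move=> ->.
Qed.

Lemma interval_thread_rep :
  connected_subset (thread_supp v) -> interval_rep thread_rep.
Proof.
move=> vC; split=> [p||].
- by rewrite dim_thread_rep; case: (b p).
- by rewrite thread_rep_support; split=> //; apply: convex_thread_supp.
exists (fun p => @row_sum_lfun K K^o (b p) 1).
rewrite thread_rep_support; split=> [p vp|p q h vp vq].
  have ip : 'I_(b p) by rewrite /b vp; exact: ord0.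
  exists (fun a : K^o => const_mx a : 'rV_(b p)) => [x|a].
    apply/rowP => j; rewrite mxE row_sum_lfunE (sum_ord_bool _ j).
    by rewrite /GRing.scale /= mulr1.
  rewrite row_sum_lfunE (sum_ord_bool _ ip) mxE.
  by rewrite /GRing.scale /= mulr1.
have iq : 'I_(b q) by rewrite /b vq; exact: ord0.
apply/lfunP => x; rewrite comp_lfunE !row_sum_lfunE.
by rewrite (sum_ord_bool _ iq) thread_rep_mapE.
Qed.

Lemma thread_rep_iota_natural p q (h : (p <= q)%O) :
  (row_sum_lfun (b q) (v q) \o rep_map thread_rep h)%VF =
  (rep_map L h \o row_sum_lfun (b p) (v p))%VF.
Proof.
apply/lfunP => x; rewrite !comp_lfunE !row_sum_lfunE linearZ /=.
have [vp|/negbNE/eqP vp0] := boolP (v p != 0); last first.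
  have p0 (i : 'I_(b p)) : False.
    by have := ord_boolP i; rewrite /b vp0 eqxx.
  rewrite big1 => [|j _].
    by rewrite big1 ?scale0r // => i _; case: (p0 i).
  by rewrite thread_rep_mapE big1 // => i _; case: (p0 i).
rewrite vT //; have [vq0|vq] := eqVneq (v q) 0; first by rewrite vq0 !scaler0.
have iq : 'I_(b q) by rewrite /b vq; exact: ord0.
by rewrite (sum_ord_bool _ iq) thread_rep_mapE.
Qed.

Definition thread_rep_iota : rep_hom thread_rep L :=
  @RepHom _ _ _ thread_rep L (fun p => row_sum_lfun (b p) (v p))
    thread_rep_iota_natural.

End IntervalOfThread.

Section DirectSums.
Context {K : fieldType} {d : Order.disp_t} {P : preorderType d}.
Implicit Types (L : rep K P) (I : choiceType).

Lemma fsbigT_seq (R : Type) (idx : R) (op : Monoid.com_law idx) I (s : seq I)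
    (F : I -> R) : uniq s -> (forall i, i \notin s -> F i = idx) ->
  \big[op/idx]_(i \in [set: I]) F i = \big[op/idx]_(i <- s) F i.
Proof.
move=> s_uniq F0; rewrite (fsbig_seq _ _ s_uniq).
by symmetry; apply: fsbig_widen => // i [_ /negP/F0].
Qed.

(** The summand at i is the interval representation carried by the support of
    v i, embedded by sending its generator to v i. *)
Lemma direct_sum_thread_rep L I (v : I -> forall p, L p)
    (vB : thread_basis v) :
  is_direct_sum (fun i => thread_rep (vB.1 i)) L.
Proof.
exists (fun i => thread_rep_iota (vB.1 i)) => p x.
have [s [s_uniq sE sB]] := vB.2 p.
have w0 (w : forall i, thread_rep (vB.1 i) p) i : i \notin s -> w i = 0.
  rewrite sE => vi; apply/rowP => j; exfalso.
  by have := ord_boolP j; rewrite (negbTE vi).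
have sumE (w : forall i, thread_rep (vB.1 i) p) :
    \sum_(i \in [set: I]) thread_rep_iota (vB.1 i) p (w i) =
    \sum_(i <- s) (\sum_j w i 0 j) *: v i p.
  rewrite (fsbigT_seq _ s_uniq) => [|i si]; last by rewrite w0 // linear0.
  by apply: eq_bigr => i _; rewrite /= row_sum_lfunE.
have fins (w : forall i, thread_rep (vB.1 i) p) :
    finite_set [set i | w i != 0].
  apply: (@sub_finite_set _ _ [set` s]); last exact: finite_seq.
  by move=> i /=; apply: contraR => si; rewrite w0.
have si_ i : i \in s -> 'I_(v i p != 0) by rewrite sE => ->; exact: ord0.
have [c [cE xE]] := basis_coord s_uniq sB.
exists (fun i => const_mx (c i x)); split=> [|w [_ wE]].
  split=> //; rewrite sumE {1}(xE x); apply: eq_big_seq => i /si_ j.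
  by rewrite (sum_ord_bool _ j) mxE.
apply/functional_extensionality_dep => i; apply/rowP => j; rewrite mxE.
have i_s : i \in s by rewrite sE (ord_boolP j).
rewrite {1}wE sumE linear_sum (bigD1_seq i) //= linearZ /= cE // eqxx.
rewrite (sum_ord_bool _ j) big_seq_cond big1 => [|k /andP[ks ki]].
  by rewrite addr0 /GRing.scale /= mulr1.
by rewrite linearZ /= cE // (negbTE ki) scaler0.
Qed.

(** The thread of a summand is the image of the vectors that its
    identification with K sends to 1. These vectors are free at each point p
    because 0 decomposes uniquely; as L p is finite-dimensional, only finitely
    many of them are nonzero, and then they span. *)
Lemma thread_basis_of_direct_sum L I (V : I -> rep K P) :
    (forall i, interval_rep (V i)) -> is_direct_sum V L ->
  exists v : I -> forall p, L p,
    thread_basis v /\ forall i, thread_supp (v i) = rep_support (V i).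
Proof.
move=> VI [iota iotaP].
pose ex i := cid (let: And3 _ _ h := VI i in h).
pose e i : forall p, 'Hom(V i p, K^o) := sval (ex i).
have eP i : (forall p, rep_support (V i) p -> bijective (e i p)) /\
    (forall p q (h : (p <= q)%O), rep_support (V i) p -> rep_support (V i) q ->
      (e i q \o rep_map (V i) h)%VF = e i p) by exact: svalP (ex i).
have v0 i p (x : V i p) : ~ rep_support (V i) p -> x = 0.
  move=> ip; have /eqP d0 : \dim {:V i p} == 0%N by apply/negPn/negP.
  have := memvf x.
  by move/eqP: d0; rewrite dimv_eq0 => /eqP ->; rewrite memv0 => /eqP.
pose u i p : V i p := ((e i p)^-1)%VF 1.
have eu i p : rep_support (V i) p -> e i p (u i p) = 1.
  move=> /((eP i).1)[g _ gK]; rewrite /u limg_lfunVK //.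
  by rewrite -(gK 1) memv_img // memvf.
have uE i p : rep_support (V i) p <-> u i p != 0.
  split=> [ip|]; last by apply: contraNP => ip; rewrite (v0 _ _ (u i p) ip).
  by apply/eqP => u0; have /eqP := eu _ _ ip; rewrite u0 linear0 eq_sym oner_eq0.
have spanu i p (x : V i p) : exists c, x = c *: u i p.
  have [ip|ip] := pselect (rep_support (V i) p); last first.
    by exists 0; rewrite scale0r; exact: v0.
  exists (e i p x); have /bij_inj ei := (eP i).1 _ ip.
  by apply: ei; rewrite linearZ /= eu // /GRing.scale /= mulr1.
have uT i p q (h : (p <= q)%O) :
    u i p != 0 -> rep_map (V i) h (u i p) = u i q.
  move=> /uE ip; have [iq|iq] := pselect (rep_support (V i) q); last first.
    by rewrite (v0 _ _ (u i q) iq) (v0 _ _ (rep_map (V i) h (u i p)) iq).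
  have /bij_inj ei := (eP i).1 _ iq; apply: ei; rewrite eu //.
  by have /lfunP/(_ (u i p)) := (eP i).2 _ _ h ip iq; rewrite comp_lfunE => ->;
    rewrite eu.
have sumE p (s : seq I) (c : I -> K) : uniq s ->
    \sum_(i \in [set: I]) iota i p (if i \in s then c i *: u i p else 0) =
    \sum_(i <- s) c i *: iota i p (u i p).
  move=> s_uniq; rewrite (fsbigT_seq _ s_uniq) => [|i /negbTE ->].
    by apply: eq_big_seq => i ->; rewrite linearZ.
  by rewrite linear0.
have fin p (s : seq I) (c : I -> K) :
    finite_set [set i | (if i \in s then c i *: u i p else 0) != 0].
  apply: (@sub_finite_set _ _ [set` s]); last exact: finite_seq.
  by move=> i /=; case: ifP => //; rewrite eqxx.
have coef0 p (s : seq I) (c : I -> K) : uniq s ->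
    \sum_(i <- s) c i *: iota i p (u i p) = 0 ->
    forall i, i \in s -> u i p != 0 -> c i = 0.
  move=> s_uniq sum0 i i_s ui.
  have [w [_ w_uniq]] := iotaP p 0.
  have w1 := w_uniq (fun i => if i \in s then c i *: u i p else 0).
  have w2 := w_uniq (fun=> 0).
  have /(congr1 (fun w => w i)) : (fun i => if i \in s then c i *: u i p else 0)
      = (fun=> 0) :> (forall i, V i p).
    rewrite -w1 ?w2 //; split; rewrite ?sumE //; last exact: fin.
      by apply: (sub_finite_set (B := set0)) => // j /=; rewrite eqxx.
    by rewrite (fsbigT_seq _ (s := [::])) ?big_nil // => j _; rewrite linear0.
  by rewrite /= i_s => /eqP; rewrite scaler_eq0 (negbTE ui) orbF => /eqP.
exists (fun i p => iota i p (u i p)).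
have suppE i p : (iota i p (u i p) != 0) = (u i p != 0).
  apply/idP/idP; first by apply: contra_neq => ->; rewrite linear0.
  move=> ui; apply/eqP => iu0.
  have := @coef0 p [:: i] (fun=> 1) erefl.
  rewrite big_seq1 iu0 scaler0 => /(_ erefl i (mem_head _ _) ui) /eqP.
  by rewrite oner_eq0.
split; last first.
  move=> i; apply/seteqP; split=> p /=; rewrite /thread_supp /= suppE.
    by move/uE.
  by move=> ip; apply/uE.
split=> [i p q h|p]; first by rewrite suppE => ui; rewrite -hom_naturalE uT.
have mapfree (s : seq I) : uniq s -> (forall i, i \in s -> u i p != 0) ->
    free [seq iota i p (u i p) | i <- s].
  move=> s_uniq su; apply: free_map => // c sum0 i i_s.
  by apply: (coef0 p s) => //; apply: su.
(* A longest list of indices of nonzero vectors contains all of them. *)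
have [s [s_uniq sE]] : exists s : seq I,
    uniq s /\ forall i, (i \in s) = (u i p != 0).
  pose has n := `[< exists s : seq I,
    [/\ uniq s, size s = n & forall i, i \in s -> u i p != 0] >].
  have [||n /asboolP[s [s_uniq sn su]] nmax] := @ex_maxnP has (\dim {:L p}).
  - by exists 0%N; apply/asboolP; exists [::].
  - move=> n /asboolP[s [s_uniq <- su]].
    rewrite -(size_map (fun i => iota i p (u i p))).
    by have /eqP <- := mapfree s s_uniq su; apply/dimvS/subvf.
  exists s; split=> // i; apply/idP/idP; first exact: su.
  move=> ui; apply: contraT => i_s.
  have /nmax : has n.+1; last by rewrite ltnn.
  apply/asboolP; exists (i :: s); rewrite /= i_s s_uniq sn; split=> // j.
  by rewrite inE => /predU1P[->//|/su].
exists s; split=> // [i|]; first by rewrite suppE.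
apply/andP; split; last by apply: mapfree => // i; rewrite sE.
rewrite eqEsubv subvf; apply/subvP => x _.
have [w [[_ ->] _]] := iotaP p x.
rewrite (fsbigT_seq _ s_uniq) => [|i]; last first.
  rewrite sE negbK => /eqP ui; have [c ->] := spanu i p (w i).
  by rewrite ui scaler0 linear0.
rewrite big_seq; apply: memv_suml => i i_s; have [c ->] := spanu i p (w i).
by rewrite linearZ /= memvZ // memv_span // (map_f (fun i => iota i p (u i p))).
Qed.
End DirectSums.

(** * Uniqueness of multiplicities *)
Section Uniqueness.
Context {K : fieldType} {d : Order.disp_t} {P : preorderType d}.
Implicit Types (L : rep K P) (I J C : choiceType).

(** The functional c i p reads the coordinate along v i at p, and is 0 where
    v i vanishes. *)
Definition thread_coord L I (v : I -> forall p, L p)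
    (c : I -> forall p, 'Hom(L p, K^o)) : Prop :=
  (forall i k p, c i p (v k p) = ((v k p != 0) && (k == i))%:R) /\
  (forall p (s : seq I) x, uniq s -> (forall i, (i \in s) = (v i p != 0)) ->
    x = \sum_(i <- s) c i p x *: v i p).

Lemma thread_coord_exists L I (v : I -> forall p, L p) :
  thread_basis v -> exists c, thread_coord v c.
Proof.
move=> vB.
have ex p : exists c : I -> 'Hom(L p, K^o),
    (forall i k, c i (v k p) = ((v k p != 0) && (k == i))%:R) /\
    (forall (s : seq I) x, uniq s -> (forall i, (i \in s) = (v i p != 0)) ->
      x = \sum_(i <- s) c i x *: v i p).
  have [s [s_uniq sE sB]] := vB.2 p.
  have [c [cE xE]] := basis_coord s_uniq sB; exists c; split=> [i k|s' x s'_uniq s'E].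
    have [ks|] := boolP (k \in s); first by rewrite cE // -sE ks.
    by rewrite sE negbK => /eqP ->; rewrite linear0 eqxx.
  rewrite {1}(xE x); apply: perm_big; apply: uniq_perm => // i.
  by rewrite sE s'E.
exists (fun i p => sval (cid (ex p)) i); split=> [i k p|p].
  exact: (svalP (cid (ex p))).1.
exact: (svalP (cid (ex p))).2.
Qed.

Lemma thread_coord0 L I (v : I -> forall p, L p) c i p :
  thread_basis v -> thread_coord v c -> v i p = 0 -> c i p = 0.
Proof.
move=> vB [cE _] vi; apply: (thread_basis_eq vB) => k vk.
rewrite cE zero_lfunE vk /=; case: eqP => // ki.
by rewrite ki vi eqxx in vk.
Qed.

(** Structure maps send basis vectors to basis vectors or to 0, so they preserve
    the coordinate along v i as long as v i has not died at the upper end. *)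
Lemma thread_coord_natural L I (v : I -> forall p, L p) c i p q
    (h : (p <= q)%O) x :
    thread_basis v -> thread_coord v c -> v i q != 0 ->
  c i p x = c i q (rep_map L h x).
Proof.
move=> vB [cE _] vi.
suff -> : c i p = (c i q \o rep_map L h)%VF by rewrite comp_lfunE.
apply: (thread_basis_eq vB) => k vk; rewrite comp_lfunE cE vB.1 // cE vk /=.
by case: eqP => [->|_]; rewrite ?vi // andbF.
Qed.

Section TwoBases.
Variables (L : rep K P) (I J : choiceType).
Variables (v : I -> forall p, L p) (w : J -> forall p, L p).
Variables (b : I -> forall p, 'Hom(L p, K^o)).
Variables (c : J -> forall p, 'Hom(L p, K^o)).
Hypotheses (vB : thread_basis v) (wB : thread_basis w).
Hypotheses (bC : thread_coord v b) (cC : thread_coord w c).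

(** The entries of the transition matrix between the bases are locally constant:
    they are the scalars that describe a morphism between two interval
    representations. *)
Lemma transition_eq i j p q : (p <= q)%O -> v i p != 0 -> w j q != 0 ->
  c j p (v i p) = c j q (v i q).
Proof.
by move=> pq vi wj; rewrite (thread_coord_natural pq _ wB cC wj) vB.1.
Qed.

Lemma transition_alive i j p : c j p (v i p) != 0 -> v i p != 0 /\ w j p != 0.
Proof.
move=> cv; split; first by apply: contra_neq cv => ->; rewrite linear0.
by apply: contra_neq cv => wj; rewrite (thread_coord0 wB cC wj) zero_lfunE.
Qed.
End TwoBases.

(** If the composite of the components v i -> w j -> v k is nonzero at some
    point, it stays nonzero along every comparability inside the union of the
    supports of v i and w j. So the set where it is nonzero is a union of
    components of either support, and by connectedness it is all of both. *)
Lemma thread_supp_eq L I J (v : I -> forall p, L p) (w : J -> forall p, L p)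
    b c i j k x :
    thread_basis v -> thread_basis w -> thread_coord v b -> thread_coord w c ->
    thread_supp (v i) = thread_supp (v k) ->
    connected_subset (thread_supp (v i)) ->
    connected_subset (thread_supp (w j)) ->
    c j x (v i x) * b k x (w j x) != 0 ->
  thread_supp (w j) = thread_supp (v i).
Proof.
move=> vB wB bC cC ik vi_conn wj_conn nz.
pose T := [set p | c j p (v i p) * b k p (w j p) != 0].
have alive p : T p -> [/\ v i p != 0, w j p != 0, v k p != 0,
    c j p (v i p) != 0 & b k p (w j p) != 0].
  rewrite /T /= mulf_eq0 negb_or => /andP[n1 n2].
  have [vi wj] := transition_alive wB cC n1.
  by have [_ vk] := transition_alive vB bC n2.
have vik p : (v i p != 0) = (v k p != 0).
  by have := congr1 (fun S => S p) ik; rewrite /thread_supp /= => E; apply/idP/idP; rewrite E.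
have up p q : T p -> (p <= q)%O -> v i q != 0 \/ w j q != 0 -> T q.
  move=> /alive[vi wj vk n1 n2] pq q_alive.
  have [wq vq] : w j q != 0 /\ v i q != 0.
    case: q_alive => [vq|wq]; last first.
      split=> //; have E := transition_eq vB wB cC pq vi wq.
      by have /(transition_alive wB cC)[] : c j q (v i q) != 0 by rewrite -E.
    split=> //; rewrite vik in vq.
    have E := transition_eq wB vB bC pq wj vq.
    by have /(transition_alive vB bC)[] : b k q (w j q) != 0 by rewrite -E.
  rewrite /T /= -(transition_eq vB wB cC pq vi wq).
  by rewrite -(transition_eq wB vB bC pq wj) -?vik // mulf_neq0.
have down p q : T p -> (q <= p)%O -> v i q != 0 \/ w j q != 0 -> T q.
  move=> /alive[vi wj vk n1 n2] qp q_alive.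
  have [wq vq] : w j q != 0 /\ v i q != 0.
    case: q_alive => [vq|wq].
      split=> //; have E := transition_eq vB wB cC qp vq wj.
      by have /(transition_alive wB cC)[] : c j q (v i q) != 0 by rewrite E.
    split=> //; have E := transition_eq wB vB bC qp wq vk.
    by have /(transition_alive vB bC)[] : b k q (w j q) != 0;
      rewrite ?E // vik.
  rewrite /T /= (transition_eq vB wB cC qp vq wj).
  by rewrite (transition_eq wB vB bC qp wq vk) mulf_neq0.
have full (S : set P) : connected_subset S -> T `<=` S ->
    (forall p, S p -> v i p != 0 \/ w j p != 0) -> S = T.
  move=> S_conn TS Sa.
  have [|||T0|D0] := S_conn T (S `\` T).
  - by rewrite setDUK.
  - by rewrite setDIK.
  - move=> p q Tp [Sq nTq]; split=> pq; apply: nTq.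
      exact: up Tp pq (Sa _ Sq).
    exact: down Tp pq (Sa _ Sq).
  - by have : T x by []; rewrite T0.
  - by apply/seteqP; split=> //; rewrite -setD_eq0.
rewrite (full (thread_supp (v i))) //.
- by rewrite (full (thread_supp (w j))) // => [p /alive[]|p]; [|right].
- by move=> p /alive[].
- by move=> p; left.
Qed.

(** At a point x of S, the identity restricted to the threads v i with support S
    factors through the threads w j, and only those with support S contribute:
    an identity matrix of size [size r] factors through size [size r']. *)
Lemma thread_count_le L I J (v : I -> forall p, L p) (w : J -> forall p, L p)
    (S : set P) (r : seq I) (r' : seq J) :
    thread_basis v -> thread_basis w ->
    S !=set0 -> connected_subset S ->
    (forall j, connected_subset (thread_supp (w j))) ->
    uniq r -> (forall i, i \in r -> thread_supp (v i) = S) ->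
    uniq r' -> (forall j, j \in r' <-> thread_supp (w j) = S) ->
  (size r <= size r')%N.
Proof.
move=> vB wB [x Sx] S_conn w_conn r_uniq rS r'_uniq r'S.
have [b bC] := thread_coord_exists vB; have [c cC] := thread_coord_exists wB.
pose A : 'M[K]_(size r, size r') := \matrix_(i, j)
  c (tnth (in_tuple r') j) x (v (tnth (in_tuple r) i) x).
pose B : 'M[K]_(size r', size r) := \matrix_(j, i)
  b (tnth (in_tuple r) i) x (w (tnth (in_tuple r') j) x).
apply: (@mulmx1_min K _ _ A B); apply/matrixP => i k.
rewrite !mxE; pose i' := tnth (in_tuple r) i; pose k' := tnth (in_tuple r) k.
have i'r : i' \in r by apply: mem_tnth.
have k'r : k' \in r by apply: mem_tnth.
transitivity (b k' x (v i' x)); last first.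
  rewrite bC.1; have -> : v i' x != 0 by have := Sx; rewrite -(rS i').
  congr (_%:R); congr (nat_of_bool _).
  by rewrite /i' /k' !(tnth_nth i') /= nth_uniq.
have [s [s_uniq sE _]] := wB.2 x.
rewrite [in RHS](cC.2 x s (v i' x) s_uniq sE) linear_sum /=.
transitivity (\sum_(j <- r') c j x (v i' x) * b k' x (w j x)).
  by rewrite [RHS]big_tnth; apply: eq_bigr => j _; rewrite !mxE.
rewrite [RHS](bigID (mem r')) /= [X in _ + X]big1 ?addr0 => [|j /negP jr'].
  under [RHS]eq_bigr do rewrite linearZ /=.
  rewrite -[RHS]big_filter; apply: perm_big; apply: uniq_perm; rewrite ?filter_uniq // => j.
  rewrite mem_filter; have [/r'S jS|//] := boolP (j \in r').
  by rewrite sE; apply/esym; have := Sx; rewrite -jS.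
apply/eqP; rewrite linearZ /=; apply: contra_notT jr' => nz; apply/r'S.
rewrite -(rS _ i'r).
by apply: (thread_supp_eq (k := k') vB wB bC cC _ _ _ nz) => //; rewrite !rS.
Qed.

End Uniqueness.

(** * Decompositions with prescribed multiplicities *)
Section Decompositions.
Context {K : fieldType} {d : Order.disp_t} {P : preorderType d}.
Implicit Types (L : rep K P) (I C : choiceType).

(** L has m c summands with support supp c. Using one index type for all L with
    given multiplicities makes two such L visibly isomorphic. *)
Definition decomposes L C (supp : C -> set P) (m : C -> nat) : Prop :=
  exists v : {c : C & 'I_(m c)} -> forall p, L p,
    thread_basis v /\ forall t, thread_supp (v t) = supp (tag t).

Definition fiber C (m : C -> nat) (c : C) : seq {c : C & 'I_(m c)} :=
  [seq Tagged (fun c => 'I_(m c)) k | k <- enum 'I_(m c)].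

Lemma size_fiber C (m : C -> nat) c : size (fiber m c) = m c.
Proof. by rewrite size_map size_enum_ord. Qed.

Lemma fiber_uniq C (m : C -> nat) c : uniq (fiber m c).
Proof.
rewrite map_inj_uniq ?enum_uniq // => i j.
by move/eqP; rewrite eq_Tagged => /eqP.
Qed.

Lemma mem_fiber C (m : C -> nat) c t : (t \in fiber m c) = (tag t == c).
Proof.
apply/mapP/eqP => [[k _ ->]//|<-].
by exists (tagged t); rewrite ?mem_enum //; case: t.
Qed.

Lemma thread_supp_eq0 L L' (v : forall p, L p) (v' : forall p, L' p) :
  thread_supp v = thread_supp v' -> forall p, v p = 0 <-> v' p = 0.
Proof.
move=> vv' p; have := congr1 (fun S => S p) vv'; rewrite /thread_supp /= => E.
by split=> /eqP z; apply/eqP; apply: contraTT z; rewrite ?E // -E.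
Qed.

Lemma decomposes_iso L L' C (supp : C -> set P) (m : C -> nat) :
  decomposes L supp m -> decomposes L' supp m -> rep_iso L L'.
Proof.
move=> [v [vB vS]] [v' [vB' vS']]; apply: (thread_basis_iso vB vB') => t.
by apply: thread_supp_eq0; rewrite vS vS'.
Qed.

Lemma decomposes_transport L L' C (supp : C -> set P) (m : C -> nat) :
  rep_iso L L' -> decomposes L supp m -> decomposes L' supp m.
Proof.
move=> LL' [v [vB vS]]; have [v' [vB' v'E]] := thread_basis_transport vB LL'.
exists v'; split=> // t; rewrite -vS; apply/seteqP.
by split=> p; apply: contra_neq => /v'E.
Qed.

Lemma decomposes_count_le L C (supp : C -> set P) (m m' : C -> nat) :
    injective supp -> (forall c, (0 < m c)%N -> connected_subset (supp c)) ->
    (forall c, (0 < m' c)%N -> connected_subset (supp c)) ->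
    decomposes L supp m -> decomposes L supp m' ->
  forall c, supp c !=set0 -> (m c <= m' c)%N.
Proof.
move=> supp_inj m_conn m'_conn [v [vB vS]] [w [wB wS]] c c0.
have [->//|m0] := posnP (m c).
rewrite -(size_fiber m) -(size_fiber m').
apply: (thread_count_le vB wB c0); rewrite ?fiber_uniq //.
- exact: m_conn.
- by move=> t; rewrite wS; apply: m'_conn; case: t => c' [k /= /(leq_ltn_trans _)->].
- by move=> t; rewrite mem_fiber vS => /eqP ->.
- by move=> t; rewrite mem_fiber wS; split=> [/eqP ->//|/supp_inj ->].
Qed.

(** The theorem of Krull, Remak, Schmidt and Azumaya for interval
    representations. Threads with empty support vanish everywhere, so their
    number is not determined by L. *)
Lemma decomposes_unique L C (supp : C -> set P) (m m' : C -> nat) :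
    injective supp -> (forall c, (0 < m c)%N -> connected_subset (supp c)) ->
    (forall c, (0 < m' c)%N -> connected_subset (supp c)) ->
    decomposes L supp m -> decomposes L supp m' ->
  forall c, supp c !=set0 -> m c = m' c.
Proof.
move=> supp_inj m_conn m'_conn Lm Lm' c c0; apply/eqP; rewrite eqn_leq.
rewrite (decomposes_count_le supp_inj _ _ Lm Lm') //.
by rewrite (decomposes_count_le supp_inj _ _ Lm' Lm).
Qed.

(** Sorting the threads by their supports; r enumerates the threads with support
    supp c, which are finitely many as they are all nonzero at a point of
    supp c. *)
Lemma decomposes_of_thread_basis L I (v : I -> forall p, L p)
    C (supp : C -> set P) :
    thread_basis v -> injective supp ->
    (forall i, thread_supp (v i) !=set0 ->
      exists c, supp c = thread_supp (v i)) ->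
  exists m : C -> nat,
    [/\ decomposes L supp m, forall c, supp c = set0 -> m c = 0%N
      & forall c, supp c !=set0 -> exists r : seq I,
          [/\ uniq r, size r = m c
            & forall i, i \in r <-> thread_supp (v i) = supp c]].
Proof.
move=> vB supp_inj vsupp.
have ex_r c : exists r : seq I, uniq r /\
    forall i, i \in r <-> supp c !=set0 /\ thread_supp (v i) = supp c.
  have [[p cp]|c0] := pselect (supp c !=set0); last first.
    by exists [::]; split=> // i; split=> // -[].
  have [s [s_uniq sE _]] := vB.2 p.
  exists [seq i <- s | `[< thread_supp (v i) = supp c >]].
  rewrite filter_uniq //; split=> // i; rewrite mem_filter.
  split=> [/andP[/asboolP vc _]|[_ vc]]; first by split=> //; exists p.
  rewrite asboolT //= sE.
  by have := cp; rewrite -vc.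
have [r rP] := choice ex_r.
pose m c := size (r c).
pose g (t : {c : C & 'I_(m c)}) : I := tnth (in_tuple (r (tag t))) (tagged t).
have gr t : g t \in r (tag t) by apply: mem_tnth.
exists m; split.
- exists (fun t => v (g t)); split; last first.
    by move=> t; have /((rP _).2)[] := gr t.
  apply: thread_basis_reindex => // [t t' gg'|i p vi].
    have tt' : tag t = tag t'.
      apply: supp_inj; have /((rP _).2)[_ <-] := gr t.
      by have /((rP _).2)[_ <-] := gr t'; rewrite gg'.
    pose i0 := g t; case: t @i0 t' tt' gg' {gr} => c k i0 [c' k'] /= cc'.
    case: _ / cc' k' => k' /eqP.
    rewrite /g /= !(tnth_nth i0).
    rewrite /= nth_uniq ?(rP c).1 // => /eqP kk'.
    by rewrite (ord_inj kk').
  have vi0 : thread_supp (v i) !=set0 by exists p.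
  have [c ci] := vsupp i vi0.
  have /(nthP i)[k lt ki] : i \in r c by apply/(rP c).2; rewrite ci.
  by exists (Tagged (fun c => 'I_(m c)) (Ordinal lt : 'I_(m c)));
    rewrite /g (tnth_nth i).
- move=> c c0; apply/eqP; rewrite size_eq0; apply/eqP.
  case rc : (r c) => [//|i s]; have /((rP c).2) : i \in r c by rewrite rc mem_head.
  by rewrite c0 => -[[]].
- move=> c c0; exists (r c); split=> //; first exact: (rP c).1.
  by move=> i; split=> [/((rP c).2)[]//|ic]; apply/(rP c).2.
Qed.

(** The direct sum of the interval representations carried by S i, when finitely
    many of the S i contain a given point p; they are listed by s p. *)
Section FreeRep.
Variables (I : choiceType) (S : I -> set P) (s : P -> seq I).
Hypotheses (S_convex : forall i, convex_subset (S i)).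
Hypotheses (s_uniq : forall p, uniq (s p)).
Hypotheses (sE : forall p i, i \in s p <-> S i p).

Let idx p (k : 'I_(size (s p))) : I := tnth (in_tuple (s p)) k.

Lemma idx_inj p : injective (@idx p).
Proof.
move=> j k; have [i0 _] : exists i0 : I, True by exists (idx j).
rewrite /idx !(tnth_nth i0) => /eqP; rewrite /= nth_uniq // => /eqP.
exact: ord_inj.
Qed.

Lemma idxP p i : S i p -> exists k : 'I_(size (s p)), idx k = i.
Proof.
move=> /sE /(nthP i)[k lt ki]; exists (Ordinal lt).
by rewrite /idx (tnth_nth i).
Qed.

Lemma idx_supp p (k : 'I_(size (s p))) : S (idx k) p.
Proof. by apply/sE; apply: mem_tnth. Qed.

Definition free_map_mx p q : 'M[K]_(size (s p), size (s q)) :=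
  \matrix_(j, k) (idx j == idx k)%:R.

Definition free_rep_map (p q : P) (_ : (p <= q)%O) :
    'Hom('rV[K]_(size (s p)), 'rV[K]_(size (s q))) :=
  linfun (mulmxr (free_map_mx p q)).

Lemma free_rep_map_id p (h : (p <= p)%O) : free_rep_map h = \1%VF.
Proof.
apply/lfunP => x; rewrite lfunE /= id_lfunE.
suff -> : free_map_mx p p = 1%:M by rewrite mulmx1.
by apply/matrixP => j k; rewrite !mxE (inj_eq (@idx_inj p)).
Qed.

Lemma free_rep_map_comp p q r (pq : (p <= q)%O) (qr : (q <= r)%O)
    (pr : (p <= r)%O) :
  free_rep_map pr = (free_rep_map qr \o free_rep_map pq)%VF.
Proof.
apply/lfunP => x; rewrite comp_lfunE !lfunE /= -mulmxA; congr (_ *m _).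
apply/matrixP => j k; rewrite !mxE.
have [jk|jk] := eqVneq (idx j) (idx k).
  have [l lE] : exists l : 'I_(size (s q)), idx l = idx j.
    apply: idxP; apply: (S_convex _ _ pq qr); first exact: idx_supp.
    by rewrite jk; exact: idx_supp.
  rewrite (bigD1 l) //= big1 => [|l' l'l].
    by rewrite !mxE lE jk !eqxx mulr1 addr0.
  by rewrite !mxE -lE (inj_eq (@idx_inj q)) eq_sym (negbTE l'l) mul0r.
rewrite big1 // => l _; rewrite !mxE.
by case: eqP => [<-|_]; rewrite ?mul0r // (negbTE jk) mulr0.
Qed.

Definition free_rep : rep K P := Rep free_rep_map_id free_rep_map_comp.

Definition free_rep_thread (i : I) (p : P) : free_rep p :=
  \row_k (idx k == i)%:R.

Lemma free_rep_thread_idx p (k : 'I_(size (s p))) :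
  free_rep_thread (idx k) p = 'e_k.
Proof. by apply/rowP => j; rewrite !mxE (inj_eq (@idx_inj p)). Qed.

Lemma free_rep_thread_supp i : thread_supp (free_rep_thread i) = S i.
Proof.
apply/seteqP; split=> p; rewrite /thread_supp /=; last first.
  move=> /idxP[k <-]; apply/eqP => /rowP/(_ k)/eqP.
  by rewrite !mxE eqxx oner_eq0.
apply: contraNP => ip; apply/eqP/rowP => k; rewrite !mxE.
by case: eqP => // ki; case: ip; rewrite -ki; apply: idx_supp.
Qed.

Lemma free_rep_basis : thread_basis free_rep_thread.
Proof.
split=> [i p q h ip|p].
  have /idxP[k <-] : S i p by rewrite -free_rep_thread_supp.
  rewrite free_rep_thread_idx lfunE /= -rowE.
  by apply/rowP => l; rewrite !mxE eq_sym.
exists (s p); split=> // [i|].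
  apply/idP/idP => [/sE|ip]; first by rewrite -free_rep_thread_supp.
  by apply/sE; rewrite -free_rep_thread_supp.
rewrite basisEdim size_map dimvf /dim /= mul1n leqnn andbT.
apply/subvP => x _; rewrite (row_sum_delta x); apply: memv_suml => k _.
rewrite memvZ // -free_rep_thread_idx memv_span // map_f //.
exact: mem_tnth.
Qed.

End FreeRep.

Lemma decomposes_exists C (supp : C -> set P) (m : C -> nat) :
    (forall c, (0 < m c)%N -> convex_subset (supp c)) ->
    (forall p, exists r : seq C, forall c, (0 < m c)%N -> supp c p -> c \in r) ->
  exists L, decomposes L supp m.
Proof.
move=> supp_convex fin.
have ex_s p : exists s : seq {c : C & 'I_(m c)},
    uniq s /\ forall t, t \in s <-> supp (tag t) p.
  have [r rP] := fin p.
  exists (undup [seq t <- flatten [seq fiber m c | c <- r] |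
            `[< supp (tag t) p >]]).
  rewrite undup_uniq; split=> // t; rewrite mem_undup mem_filter.
  split=> [/andP[/asboolP]//|tp]; rewrite asboolT //=.
  apply/flattenP; exists (fiber m (tag t)); rewrite ?mem_fiber //.
  apply/map_f/rP => //.
  by case: t {tp} => c [k /= /(leq_ltn_trans _)->].
have [s sP] := choice ex_s.
have tag_convex (t : {c : C & 'I_(m c)}) : convex_subset (supp (tag t)).
  by apply: supp_convex; case: t => c [k /= /(leq_ltn_trans _)->].
exists (free_rep tag_convex (fun p => (sP p).1)
  (fun p => (sP p).2)).
eexists; split; first exact: free_rep_basis.
by move=> t; rewrite free_rep_thread_supp.
Qed.

Lemma decomposes_interval_rep L C (supp : C -> set P) (m : C -> nat) :
    (forall c, (0 < m c)%N -> connected_subset (supp c)) ->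
    decomposes L supp m ->
  exists V : {c : C & 'I_(m c)} -> rep K P,
    (forall t, interval_rep (V t) /\ rep_support (V t) = supp (tag t)) /\
    is_direct_sum V L.
Proof.
move=> m_conn [v [vB vS]]; exists (fun t => thread_rep (vB.1 t)); split; last first.
  exact: direct_sum_thread_rep.
move=> t; rewrite -vS thread_rep_support; split=> //.
apply: interval_thread_rep; rewrite vS; apply: m_conn.
by case: t => c [k /= /(leq_ltn_trans _)->].
Qed.

End Decompositions.

(** * Bases adapted to two chains of subspaces *)
Section AdaptedBases.
Context {K : fieldType} {V : vectType K}.
Implicit Types (b : seq V) (U : {vspace V}) (A : {vspace V} -> Prop).

(** For a basis b this says that the members of b lying in U span U. This form
    also makes sense for free families, and with it the property restricts to
    sublists. *)
Definition adapted b U : Prop := forall k : V -> K,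
  \sum_(y <- b) k y *: y \in U -> forall y, y \in b -> k y != 0 -> y \in U.

Definition chain A : Prop :=
  forall U U', A U -> A U' -> (U <= U')%VS \/ (U' <= U)%VS.

Lemma chain_min A (Q : {vspace V} -> Prop) : chain A ->
    (exists U, A U /\ Q U) ->
  exists U, [/\ A U, Q U & forall U', A U' -> Q U' -> (U <= U')%VS].
Proof.
move=> A_chain [U [AU QU]].
pose has n := `[< exists U, [/\ A U, Q U & \dim U = n] >].
have ex_has : exists n, has n by exists (\dim U); apply/asboolP; exists U.
case: (ex_minnP ex_has) => n /asboolP[U0 [AU0 QU0 <-]] n_min.
exists U0; split=> // U' AU' QU'; have [//|U'U0] := A_chain _ _ AU0 AU'.
have : (\dim U0 <= \dim U')%N by apply: n_min; apply/asboolP; exists U'.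
by move=> dimU; have /eqP -> : U' == U0 by rewrite eqEdim U'U0.
Qed.

Lemma chainT A : chain A -> chain (fun U => A U \/ U = fullv).
Proof.
move=> A_chain U U' [AU|->] [AU'|->]; rewrite ?subvf; auto.
Qed.

(** The basis is built one vector at a time, keeping the span of the current
    family c comparable to all members of A. The next vector is taken in the
    smallest member I0 of A not inside the span, and in the smallest member K0
    of B such that K0 :&: I0 is not inside the span. A member of A or B that
    contains a vector involving the new vector v then contains v. *)
Lemma adapted_chains A B : chain A -> chain B ->
  exists b, basis_of fullv b /\ forall U, A U \/ B U -> adapted b U.
Proof.
move=> A_chain B_chain.
suff /(_ (\dim {:V}) (leqnn _)) [b [b_free b_size _ bAB]] :
    forall n, (n <= \dim {:V})%N -> exists b, [/\ free b, size b = n,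
      forall U, A U -> (U <= <<b>>)%VS \/ (<<b>> <= U)%VS
      & forall U, A U \/ B U -> adapted b U].
  exists b; split=> //; rewrite basisEfree b_free subvf b_size.
  exact: leqnn.
elim=> [_|n IH n_lt].
  exists [::]; split=> //; first by rewrite nil_free.
  by move=> U _; right; rewrite span_nil sub0v.
have [c [c_free c_size c_compat cAB]] := IH (ltnW n_lt).
have nfull : ~ (fullv <= <<c>>)%VS.
  move=> /dimvS; rewrite leqNgt; case/negP.
  by rewrite (leq_ltn_trans (dim_span c)) // c_size.
have [|I0 [AI0 I0c I0min]] := chain_min (Q := fun U => ~ (U <= <<c>>)%VS) (chainT A_chain).
  by exists fullv; split=> //; right.
have [|K0 [BK0 K0c K0min]] :=
    chain_min (Q := fun U => ~ (U :&: I0 <= <<c>>)%VS) (chainT B_chain).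
  by exists fullv; split; [right|rewrite capfv].
have [v] : exists2 v, v \in (K0 :&: I0)%VS & v \notin <<c>>%VS.
  by apply/subvPn/negP.
rewrite memv_cap => /andP[vK0 vI0] vc.
have cI0 : (<<c>> <= I0)%VS.
  by case: AI0 => [/c_compat[/I0c|]//|->]; rewrite subvf.
have I0le U : A U -> ~ (U <= <<c>>)%VS -> (I0 <= U)%VS.
  by move=> AU; apply: I0min; left.
have mem_sum (k : V -> K) : \sum_(y <- c) k y *: y \in <<c>>%VS.
  by rewrite big_seq; apply: memv_suml => y yc; rewrite memvZ // memv_span.
have cv_le U : (I0 <= U)%VS -> (<<v :: c>> <= U)%VS.
  move=> I0U; apply: subv_trans I0U.
  by rewrite span_cons subv_add cI0 andbT -memvE.
exists (v :: c); split; rewrite /= ?c_size //.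
- by rewrite free_cons vc.
- move=> U AU; have [Uc|/negP/(I0le _ AU)/cv_le] := boolP (U <= <<c>>)%VS; last by right.
  by left; rewrite span_cons (subv_trans Uc) // addvSr.
move=> U ABU k; rewrite big_cons.
have [kv0|kv] := eqVneq (k v) 0.
  rewrite kv0 scale0r add0r => kU y; rewrite inE => /predU1P[->|yc].
    by rewrite kv0 eqxx.
  exact: cAB kU y yc.
set x := (X in X \in U) => xU.
have xc : x \notin <<c>>%VS.
  rewrite rpredDr ?mem_sum //; apply: contra vc => kvc.
  by rewrite -(scale1r v) -(mulVf kv) -scalerA memvZ.
case: (ABU) => [AU|BU].
  have /cv_le/span_subvP sub : (I0 <= U)%VS.
    by apply: I0le => // /subvP/(_ _ xU); apply/negP.
  by move=> y yc _; apply: sub.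
have xI0 : x \in I0.
  by rewrite memvD ?memvZ // (subvP cI0).
have K0U : (K0 <= U)%VS.
  apply: K0min; first by left.
  by move=> /subvP/(_ x); rewrite memv_cap xU xI0 => /(_ erefl); apply/negP.
have vU : v \in U by apply: (subvP K0U).
move=> y; rewrite inE => /predU1P[->//|yc].
apply: cAB ABU _ _ y yc; move: xU.
by rewrite rpredDl // memvZ.
Qed.

Lemma basis_span b x : basis_of fullv b -> exists k : V -> K,
  x = \sum_(y <- b) k y *: y.
Proof.
move=> bB; have xb : x \in <<b>>%VS by rewrite (span_basis bB) memvf.
by have [k -> _] := free_span (basis_free bB) xb; exists k.
Qed.

Lemma free_coef0 b (k : V -> K) : free b -> \sum_(y <- b) k y *: y = 0 ->
  forall y, y \in b -> k y = 0.
Proof.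
move=> b_free k0 y yb.
have [k' _ k'E] := free_span b_free (mem0v _).
rewrite (k'E k) // -(k'E (fun=> 0)) // big1 // => z _.
by rewrite scale0r.
Qed.

Lemma free_coef_eq b (k k' : V -> K) : free b ->
  \sum_(y <- b) k y *: y = \sum_(y <- b) k' y *: y ->
  forall y, y \in b -> k y = k' y.
Proof.
move=> b_free kk' y yb; apply/eqP; rewrite -subr_eq0; apply/eqP.
apply: (free_coef0 (k := fun z => k z - k' z) b_free) yb.
under eq_bigr do rewrite scalerBl.
by rewrite sumrB kk' subrr.
Qed.

Lemma adapted0 b : free b -> adapted b 0.
Proof.
move=> b_free k; rewrite memv0 => /eqP /(free_coef0 b_free) k0 y /k0 ->.
by rewrite eqxx.
Qed.

Lemma adapted_filter (p : pred V) b U : adapted b U ->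
  adapted [seq y <- b | p y] U.
Proof.
move=> bU k kU y; rewrite mem_filter => /andP[py yb] ky.
suff sU : \sum_(z <- b) (if p z then k z else 0) *: z \in U.
  by have := bU _ sU y yb; rewrite py; apply.
move: kU; rewrite big_filter big_mkcond /=; congr (_ \in U).
by apply: eq_bigr => z _; case: ifP; rewrite ?scale0r.
Qed.

Lemma adapted_span b U x : basis_of fullv b -> adapted b U -> x \in U ->
  exists k : V -> K, x = \sum_(y <- [seq y <- b | y \in U]) k y *: y.
Proof.
move=> bB bU xU; have [k xE] := basis_span x bB; exists k.
rewrite big_filter [RHS]big_mkcond {1}xE; apply: eq_big_seq => y yb.
case: ifP => // /negP yU; have [->|ky] := eqVneq (k y) 0; first by rewrite scale0r.
by case: yU; apply: bU ky => //; rewrite -xE.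
Qed.

Lemma adapted_compl b U (k : V -> K) : adapted b U ->
    \sum_(y <- [seq y <- b | y \notin U]) k y *: y \in U ->
  forall y, y \in b -> y \notin U -> k y = 0.
Proof.
move=> bU kU y yb yU; apply/eqP; apply: contraTT (yU) => ky; apply/negPn.
by apply: (adapted_filter bU kU) ky; rewrite mem_filter yU.
Qed.

(** More precise than adaptedness to the sum: by uniqueness of coordinates, a
    basis vector that occurs in u + u' occurs in u or in u'. *)
Lemma adapted_add b U U' (k : V -> K) : basis_of fullv b ->
    adapted b U -> adapted b U' -> \sum_(y <- b) k y *: y \in (U + U')%VS ->
  forall y, y \in b -> k y != 0 -> (y \in U) || (y \in U').
Proof.
move=> bB bU bU' /memv_addP[u uU [u' u'U' uu']] y yb.
have [a aE] := basis_span u bB; have [a' a'E] := basis_span u' bB.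
have kE : k y = a y + a' y.
  apply: (free_coef_eq (k' := fun z => a z + a' z) (basis_free bB) _ yb).
  by rewrite uu' aE a'E -big_split; apply: eq_bigr => z _; rewrite scalerDl.
have [ay|ay _] := eqVneq (a y) 0.
  rewrite kE ay add0r => a'y; apply/orP; right.
  by apply: bU' yb a'y; rewrite -a'E.
by apply/orP; left; apply: bU yb ay; rewrite -aE.
Qed.

End AdaptedBases.

(** * Continuing adapted bases along a persistence module *)
Section AdaptedSteps.
Context {K : fieldType} (M : rep K int).

(** These two chains record how far to the left a vector of M k lifts, and how
    far to the right it survives. *)
Definition images (k : int) (U : {vspace M k}) : Prop :=
  exists l (h : (l <= k)%O), U = limg (rep_map M h).

Definition kernels (k : int) (U : {vspace M k}) : Prop :=
  exists m (h : (k <= m)%O), U = lker (rep_map M h).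

Lemma chain_images k : chain (@images k).
Proof.
have sub l l' (h : (l <= k)%O) (h' : (l' <= k)%O) : (l <= l')%O ->
    (limg (rep_map M h) <= limg (rep_map M h'))%VS.
  by move=> ll'; rewrite (rep_map_comp M ll' h' h) limg_comp limgS ?subvf.
move=> _ _ [l [h ->]] [l' [h' ->]].
by have [ll'|/ltW l'l] := leP l l'; [left|right]; apply: sub.
Qed.

Lemma chain_kernels k : chain (@kernels k).
Proof.
have sub m m' (h : (k <= m)%O) (h' : (k <= m')%O) : (m <= m')%O ->
    (lker (rep_map M h) <= lker (rep_map M h'))%VS.
  move=> mm'; apply/subvP => x; rewrite !memv_ker (rep_mapE h mm' h') => /eqP ->.
  by rewrite linear0.
move=> _ _ [m [h ->]] [m' [h' ->]].
by have [mm'|/ltW m'm] := leP m m'; [left|right]; apply: sub.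
Qed.

Definition adapted_basis k (b : seq (M k)) : Prop :=
  basis_of fullv b /\ forall U, images U \/ kernels U -> adapted b U.

Lemma adapted_basis_exists k : exists b : seq (M k), adapted_basis b.
Proof. exact: adapted_chains (@chain_images k) (@chain_kernels k). Qed.

Definition linked k k' (b : seq (M k)) (b' : seq (M k')) : Prop :=
  forall (h : (k <= k')%O) x, x \in b -> rep_map M h x != 0 ->
    rep_map M h x \in b'.

Lemma limg_rep_map_refl l k (h : (l <= k)%O) : l = k ->
  limg (rep_map M h) = fullv.
Proof. by move=> lk; subst l; rewrite rep_map_id lim1g. Qed.

Section Step.
Variables (k k' : int) (h : (k <= k')%O).
Hypothesis kk' : k' = k + 1.
Let f := rep_map M h.

Lemma image_le l (hl : (l <= k)%O) (hl' : (l <= k')%O) :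
  limg (rep_map M hl') = (f @: limg (rep_map M hl))%VS.
Proof. by rewrite (rep_map_comp M hl h hl') limg_comp. Qed.

Lemma kernel_mem m (hm : (k <= m)%O) (hm' : (k' <= m)%O) x :
  (f x \in lker (rep_map M hm')) = (x \in lker (rep_map M hm)).
Proof. by rewrite !memv_ker (rep_mapE h hm' hm). Qed.

Lemma images_limg : images (limg f). Proof. by exists k, h. Qed.
Lemma kernels_lker : kernels (lker f). Proof. by exists k', h. Qed.

(** The images f x of the basis vectors not killed by f form a basis of limg f,
    which is completed by the members outside limg f of any basis d adapted at
    k'. For l <= k, a vector of the image of M l lies in limg f, so a preimage
    of it lies in the image of M l in M k up to an element of lker f. A vector
    of a kernel splits along limg f and the rest because d is adapted to both
    limg f and that kernel. *)
Lemma adapted_basis_right (b : seq (M k)) : adapted_basis b ->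
  exists b' : seq (M k'), adapted_basis b' /\ linked b b'.
Proof.
move=> [bB bUK]; have [d [dB dUK]] := adapted_basis_exists k'.
have b_free := basis_free bB; have d_free := basis_free dB.
have d_img := dUK _ (or_introl images_limg).
have b_ker := bUK _ (or_intror kernels_lker).
pose b1 := [seq x <- b | f x != 0]; pose d2 := [seq y <- d | y \notin limg f].
have b1_uniq : uniq b1 by rewrite filter_uniq // free_uniq.
have fb1_free : free [seq f x | x <- b1].
  apply: free_map => // c sum0 x xb1.
  have /(adapted_filter b_ker)/(_ x xb1) : \sum_(y <- b1) c y *: y \in lker f.
    rewrite memv_ker linear_sum -[X in _ == X]sum0; apply/eqP.
    by apply: eq_bigr => y _; rewrite linearZ.
  have := xb1; rewrite mem_filter memv_ker => /andP[/negbTE -> _].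
  by case: eqP => // _ /(_ isT).
have fb1_span : <<[seq f x | x <- b1]>>%VS = limg f.
  rewrite -(span_basis bB) limg_span; apply/eqP; rewrite eqEsubv; apply/andP.
  split; first by apply: sub_span => _ /mapP[x + ->];
    rewrite mem_filter => /andP[_ xb]; rewrite map_f.
  apply/span_subvP => _ /mapP[x xb ->]; have [->|fx] := eqVneq (f x) 0.
    by rewrite mem0v.
  by rewrite memv_span // map_f // mem_filter fx.
pose b' := [seq f x | x <- b1] ++ d2.
have sum_d2 (c : M k' -> K) : \sum_(y <- d2) c y *: y \in limg f ->
    \sum_(y <- d2) c y *: y = 0.
  move=> /(adapted_compl d_img) c0; rewrite big_filter big1_seq // => y.
  by case/andP=> yf yd; rewrite c0 // scale0r.
have b'B : basis_of fullv b'.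
  have -> : {:M k'}%VS = (limg f + <<d2>>)%VS.
    apply/eqP; rewrite eq_sym eqEsubv subvf -(span_basis dB) /=.
    apply/span_subvP => y yd; have [yf|yf] := boolP (y \in limg f).
      by rewrite (subvP (addvSl _ _)).
    by rewrite (subvP (addvSr _ _)) // memv_span // mem_filter yf.
  apply: cat_basis; first last.
  - by apply/andP; split=> //; apply: filter_free.
  - by apply/andP; split=> //; rewrite fb1_span.
  apply/directv_addP/eqP; rewrite -subv0; apply/subvP => y.
  rewrite memv_cap memv0 => /andP[yf].
  have d2_free : free d2 by apply: filter_free.
  by move=> /(free_span d2_free)[c yE _]; rewrite yE in yf *; rewrite sum_d2.
exists b'; split; last first.
  move=> h' x xb; rewrite (bool_irrelevance h' h) => fx.
  by rewrite mem_cat map_f // mem_filter fx.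
split=> // U UK c; rewrite big_cat big_map /=.
have fsum : \sum_(x <- b1) c (f x) *: f x = f (\sum_(x <- b1) c (f x) *: x).
  by rewrite linear_sum; apply: eq_bigr => x _; rewrite linearZ.
rewrite fsum; set z1 := \sum_(x <- b1) _; set z2 := \sum_(y <- d2) _ => zU.
suff [fz1U z2U] : (forall x, x \in b1 -> c (f x) != 0 -> f x \in U) /\ z2 \in U.
  move=> y; rewrite mem_cat => /orP[/mapP[x xb1 ->]|yd2]; first exact: fz1U.
  by apply: (adapted_filter (dUK U UK)) yd2.
case: (UK) => [[l [hl' UE]]|[m [hm' UE]]].
  have [lk'|lk'] := eqVneq l k'.
    by split=> [x _ _|]; rewrite UE limg_rep_map_refl // memvf.
  have hl : (l <= k)%O by rewrite -ltzD1 -kk' lt_neqAle lk'.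
  rewrite UE (image_le hl hl') in zU *.
  have z20 : z2 = 0.
    apply: sum_d2; rewrite -/z2.
    have -> : z2 = f z1 + z2 - f z1 by rewrite addrC addKr.
    rewrite memvB ?memv_img ?memvf //.
    by apply: subvP zU; rewrite limgS ?subvf.
  rewrite z20 addr0 in zU *; split; last by rewrite mem0v.
  move=> x xb1 cx; move: (xb1); rewrite mem_filter => /andP[fx xb].
  have [u uA uE] := memv_imgP zU.
  suff : (x \in limg (rep_map M hl)) || (x \in lker f).
    rewrite memv_ker (negbTE fx) orbF; exact: memv_img.
  apply: (adapted_add (k := fun y => if f y != 0 then c (f y) else 0) bB) xb _.
  - by apply: bUK; left; exists l, hl.
  - exact: b_ker.
  - have -> : \sum_(y <- b) (if f y != 0 then c (f y) else 0) *: y = z1.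
      rewrite /z1 big_filter [RHS]big_mkcond /=; apply: eq_bigr => y _.
      by case: ifP; rewrite ?scale0r.
    apply/memv_addP; exists u => //; exists (z1 - u); last by rewrite addrC subrK.
    by rewrite memv_ker linearB /= uE subrr.
  - by rewrite fx.
have hm : (k <= m)%O by exact: (le_trans h hm').
have z2U : z2 \in U.
  have [e eE] := adapted_span dB d_img (memv_img f (memvf z1)).
  rewrite /z2 big_seq; apply: memv_suml => y; rewrite mem_filter => /andP[yf yd].
  have [->|cy] := eqVneq (c y) 0; first by rewrite scale0r mem0v.
  rewrite memvZ //.
  apply: (dUK U UK (fun y => if y \in limg f then e y else c y)) yd _; last first.
    by rewrite (negbTE yf).
  move: zU; rewrite eE /z2 !big_filter; congr (_ \in U).
  rewrite [RHS](bigID (mem (limg f))) /=; congr (_ + _); apply: eq_bigr => z.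
    by move=> ->.
  by move=> /negbTE ->.
split=> // x xb1 cx.
have := zU; rewrite rpredDr // UE !(kernel_mem hm hm') => z1k.
apply: (adapted_filter _ z1k) xb1 cx.
by apply: bUK; right; exists m, hm.
Qed.

(** The dual exchange. Each basis vector w of M k' in limg f is lifted to M k,
    inside the smallest image containing a lift, hence inside every image
    from the left that w comes from; kernels take care of themselves, as the
    kernels of the maps out of M k to the right of k' are preimages under f. The
    members inside lker f of any basis d adapted at k complete these lifts. *)
Lemma adapted_basis_left (b' : seq (M k')) : adapted_basis b' ->
  exists b : seq (M k), adapted_basis b /\ linked b b'.
Proof.
move=> [b'B b'UK]; have [d [dB dUK]] := adapted_basis_exists k.
have b'_free := basis_free b'B; have d_free := basis_free dB.
have b'_img := b'UK _ (or_introl images_limg).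
have d_ker := dUK _ (or_intror kernels_lker).
have ex_lift w : exists v, w \in limg f -> f v = w /\
    forall l (hl : (l <= k)%O) (hl' : (l <= k')%O),
      w \in limg (rep_map M hl') -> v \in limg (rep_map M hl).
  have [wf|] := boolP (w \in limg f); last by exists 0.
  have [|_ [[l [hl ->]] /memv_imgP[v vl wE] lmin]] :=
      chain_min (Q := fun U => w \in (f @: U)%VS) (@chain_images k).
    by exists fullv; split=> //; exists k, (lexx k); rewrite rep_map_id lim1g.
  exists v => _; split=> // l1 hl1 hl1' wl1.
  apply: subvP (v) vl; apply: lmin; first by exists l1, hl1.
  by rewrite -(image_le hl1 hl1').
have [g gP] := choice ex_lift.
pose w1 := [seq w <- b' | w \in limg f]; pose d1 := [seq y <- d | y \in lker f].
have w1f w : w \in w1 -> f (g w) = w.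
  by rewrite mem_filter => /andP[wf _]; have [] := gP w wf.
have w1_free : free w1 by apply: filter_free.
have w1_uniq : uniq w1 by apply: free_uniq.
have f_sum (c : M k -> K) : f (\sum_(w <- w1) c (g w) *: g w) =
    \sum_(w <- w1) c (g w) *: w.
  rewrite linear_sum; apply: eq_big_seq => w ww1.
  by rewrite linearZ /= w1f.
have f_d1 (c : M k -> K) : f (\sum_(y <- d1) c y *: y) = 0.
  apply/eqP; rewrite -memv_ker big_seq; apply: memv_suml => y.
  by rewrite mem_filter => /andP[yf _]; rewrite memvZ.
have g_inj : {in w1 &, injective g}.
  by move=> w w' ww1 w'w1 gg'; rewrite -(w1f w) // -(w1f w') // gg'.
pose b := [seq g w | w <- w1] ++ d1.
have b_free : free b.
  have gw1_free : free [seq g w | w <- w1].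
    apply: free_map => // c sum0; apply: (free_coef0 w1_free).
    have := congr1 f sum0; rewrite linear0 linear_sum /= => {}sum0.
    by rewrite -[RHS]sum0; apply: eq_big_seq => w ww1; rewrite linearZ /= w1f.
  rewrite cat_free gw1_free filter_free //=.
  apply/directv_addP/eqP; rewrite -subv0; apply/subvP => y.
  rewrite memv_cap memv0 => /andP[/(free_span gw1_free)[c -> _] yd1].
  have := yd1; have d1_free : free d1 by apply: filter_free.
  move=> /(free_span d1_free)[e yE _]; rewrite big_map in yE *.
  have := f_d1 e; rewrite -yE f_sum => /(free_coef0 (k := c \o g) w1_free) c0.
  by rewrite big1_seq // => w /andP[_ /c0 /= ->]; rewrite scale0r.
have bB : basis_of fullv b.
  apply/andP; split=> //; rewrite eqEsubv subvf; apply/subvP => x _.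
  have [e eE] := adapted_span b'B b'_img (memv_img f (memvf x)).
  pose z := \sum_(w <- w1) e (f (g w)) *: g w.
  have fz : f z = f x.
    by rewrite (f_sum (e \o f)) eE; apply: eq_big_seq => w ww1 /=; rewrite w1f.
  have xz_ker : x - z \in lker f by rewrite memv_ker linearB /= fz subrr.
  have [e' e'E] := adapted_span dB d_ker xz_ker.
  rewrite -(subrK z x) e'E memvD //.
    rewrite big_seq; apply: memv_suml => y yd1.
    by rewrite memvZ // memv_span // mem_cat yd1 orbT.
  rewrite /z big_seq; apply: memv_suml => w ww1.
  by rewrite memvZ // memv_span // mem_cat map_f.
exists b; split; last first.
  move=> h' x; rewrite (bool_irrelevance h' h) mem_cat => /orP[/mapP[w ww1 ->] _|].
    by rewrite -/f w1f //; move: ww1; rewrite mem_filter => /andP[].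
  by rewrite mem_filter memv_ker => /andP[/eqP fx _]; rewrite -/f fx eqxx.
split=> // U UK; have [->|U0] := eqVneq U 0%VS; first exact: adapted0.
(* Both kinds of subspaces are seen through f on the lifts. *)
have [U' U'K [fU gU]] : exists2 U', images U' \/ kernels U' &
    (forall x, x \in U -> f x \in U') /\
    (forall w, w \in w1 -> w \in U' -> g w \in U).
  case: (UK) => [[l [hl UE]]|[m [hm UE]]].
    have hl' : (l <= k')%O := le_trans hl h.
    exists (limg (rep_map M hl')); first by left; exists l, hl'.
    rewrite UE; split=> [x xU|w ww1 wU']; first by rewrite (image_le hl hl') memv_img.
    move: ww1; rewrite mem_filter => /andP[wf _].
    by have [_ lift] := gP w wf; apply: lift wU'.
  have [mk|mk] := eqVneq m k.
    subst m; case/negP: U0; rewrite UE rep_map_id.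
    by apply/lker0P => x y; rewrite !id_lfunE.
  have hm' : (k' <= m)%O by rewrite kk' -ltzD1 ltrD2r lt_neqAle eq_sym mk.
  exists (lker (rep_map M hm')); first by right; exists m, hm'.
  rewrite UE; split=> [x xU|w ww1 wU']; first by rewrite (kernel_mem hm hm').
  by rewrite -(kernel_mem hm hm') w1f.
move=> c; rewrite big_cat big_map /=.
set z1 := \sum_(w <- w1) _; set z2 := \sum_(y <- d1) _ => zU.
have gU1 w : w \in w1 -> c (g w) != 0 -> g w \in U.
  move=> ww1 cw; apply: gU => //.
  apply: (adapted_filter (b'UK _ U'K) (k := c \o g) _) ww1 cw.
  rewrite -f_sum -/z1 (_ : f z1 = f (z1 + z2)) ?fU //.
  by rewrite linearD /= f_d1 addr0.
have z1U : z1 \in U.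
  rewrite /z1 big_seq; apply: memv_suml => w ww1.
  have [->|cw] := eqVneq (c (g w)) 0; first by rewrite scale0r mem0v.
  by rewrite memvZ // gU1.
rewrite rpredDl // in zU.
move=> y; rewrite mem_cat => /orP[/mapP[w ww1 ->]|yd1]; first exact: gU1.
by apply: (adapted_filter (dUK U UK) zU) yd1.
Qed.

End Step.
End AdaptedSteps.

(** * Every persistence module has a thread basis *)
Section LinkedBases.
Context {K : fieldType} (M : rep K int).

(** Starting from an adapted basis at 0, continue in both directions. *)
Lemma linked_bases_exist : exists b : forall k, seq (M k),
  (forall k, adapted_basis (b k)) /\
  forall k k', k' = k + 1 -> linked (b k) (b k').
Proof.
pose G k := {b : seq (M k) | adapted_basis b}.
have right k k' (kk' : k' = k + 1) (b : G k) :
    {b' : G k' | linked (sval b) (sval b')}.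
  have h : (k <= k')%O by rewrite kk' lerDl.
  apply: cid; have [b' [b'G bb']] := adapted_basis_right h kk' (svalP b).
  by exists (exist _ b' b'G).
have left k k' (kk' : k' = k + 1) (b' : G k') :
    {b : G k | linked (sval b) (sval b')}.
  have h : (k <= k')%O by rewrite kk' lerDl.
  apply: cid; have [b [bG bb']] := adapted_basis_left h kk' (svalP b').
  by exists (exist _ b bG).
have S n : Posz n.+1 = Posz n + 1 by rewrite intS addrC.
have N n : Negz n = Negz n.+1 + 1 by rewrite !NegzE [in RHS]intS opprD addrC addrA subrr add0r.
have N0 : Posz 0 = Negz 0 + 1 by [].
pose b0 : G (Posz 0) := let: exist b bG := cid (@adapted_basis_exists K M 0) in exist _ b bG.
pose bP := fix bP n : G (Posz n) :=
  if n is n'.+1 then sval (right _ _ (S n') (bP n')) else b0.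
pose bN := fix bN n : G (Negz n) :=
  if n is n'.+1 then sval (left _ _ (N n') (bN n')) else sval (left _ _ N0 b0).
pose b k : G k := match k with Posz n => bP n | Negz n => bN n end.
exists (fun k => sval (b k)); split=> [k|]; first exact: svalP.
case=> n k'.
  by rewrite -S => -> /=; exact: (svalP (right _ _ (S n) (bP n))).
case: n => [|n].
  by rewrite -N0 => ->; exact: (svalP (left _ _ N0 b0)).
by rewrite -N => ->; exact: (svalP (left _ _ (N n) (bN n))).
Qed.

Lemma linked_step (b : forall k, seq (M k)) :
    (forall k, adapted_basis (b k)) ->
    (forall k k', k' = k + 1 -> linked (b k) (b k')) ->
  forall k k', linked (b k) (b k').
Proof.
move=> bG bl k k' h; have [n kn] : exists n : nat, k' = k + n%:Z.
  by exists `|k' - k|%N; rewrite gez0_abs ?subr_ge0 // subrKC.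
elim: n k' h kn => [|n IH] k' h kn x xb.
  by rewrite addr0 in kn; subst k'; rewrite rep_map1.
pose k1 := k + n%:Z.
have h1 : (k <= k1)%O by rewrite lerDl.
have k1k' : k' = k1 + 1 by rewrite kn intS addrCA addrC.
have h2 : (k1 <= k')%O by rewrite k1k' lerDl.
rewrite (rep_mapE h1 h2 h) => fx; apply: (bl _ _ k1k') => //.
by apply: IH => //; apply: contra_neq fx => ->; rewrite linear0.
Qed.

(** If x and y have the same image, then x - y is in the kernel, and if
    they differ, adaptedness puts x itself in the kernel. *)
Lemma adapted_basis_inj k k' (h : (k <= k')%O) (b : seq (M k)) x y :
    adapted_basis b -> x \in b -> y \in b -> rep_map M h x != 0 ->
  rep_map M h x = rep_map M h y -> x = y.
Proof.
move=> [bB bUK] xb yb fx fxy; apply/eqP; apply: contra_neqT fx => xy.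
have b_uniq := free_uniq (basis_free bB).
have /bUK bh : images (lker (rep_map M h)) \/ kernels (lker (rep_map M h)).
  by right; exists k', h.
apply/eqP; rewrite -memv_ker.
apply: (bh (fun z => (z == x)%:R - (z == y)%:R)) (xb) _; last first.
  by rewrite eqxx (negbTE xy) subr0 oner_neq0.
rewrite memv_ker linear_sum; under eq_bigr do rewrite linearZ /= scalerBl.
rewrite sumrB (bigD1_seq x) //= eqxx scale1r big1 => [|z /negbTE ->]; last by rewrite scale0r.
rewrite (bigD1_seq y) //= eqxx scale1r big1 => [|z /negbTE ->]; last by rewrite scale0r.
by rewrite fxy subrr.
Qed.

Section Threads.
Variable b : forall k, seq (M k).
Hypotheses (bG : forall k, adapted_basis (b k)).
Hypotheses (bl : forall k k', linked (b k) (b k')).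

Let T := {k : int & M k}.

Definition on_basis (t : T) : Prop := tagged t \in b (tag t).

Definition joined (t t' : T) : Prop :=
  (exists h : (tag t <= tag t')%O, rep_map M h (tagged t) = tagged t') \/
  (exists h : (tag t' <= tag t)%O, rep_map M h (tagged t') = tagged t).

Lemma joined_refl t : joined t t.
Proof. by left; exists (lexx _); rewrite rep_map1. Qed.

Lemma joined_sym t t' : joined t t' -> joined t' t.
Proof. by case=> [[h E]|[h E]]; [right|left]; exists h. Qed.

Lemma on_basis_neq0 t : on_basis t -> tagged t != 0.
Proof. by move=> tb; apply: basis_not0 tb; exact: (bG _).1. Qed.

(** When t1 and t3 are both sent to t2, injectivity of the structure maps
    on the basis vectors that survive shows that one of them is sent to the
    other. *)
Lemma joined_trans t1 t2 t3 : on_basis t1 -> on_basis t2 -> on_basis t3 ->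
  joined t1 t2 -> joined t2 t3 -> joined t1 t3.
Proof.
move=> b1 b2 b3; have n2 := on_basis_neq0 b2.
case=> -[h12 E12] [] [h23 E23].
- left; have h := le_trans h12 h23; exists h.
  by rewrite (rep_mapE h12 h23) E12.
- have [h|/ltW h] := leP (tag t1) (tag t3); [left|right]; exists h.
    apply: (@adapted_basis_inj _ _ h23 (b (tag t3))) => //.
    + apply: (bl (h := h)) => //; apply: contra_neq n2 => E.
      by rewrite -E12 (rep_mapE h h23) E linear0.
    + by rewrite -(rep_mapE h h23 h12) E12.
    + by rewrite -(rep_mapE h h23 h12) E12 E23.
  apply: (@adapted_basis_inj _ _ h12 (b (tag t1))) => //.
  + apply: (bl (h := h)) => //; apply: contra_neq n2 => E.
    by rewrite -E23 (rep_mapE h h12) E linear0.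
  + by rewrite -(rep_mapE h h12 h23) E23.
  + by rewrite -(rep_mapE h h12 h23) E12 E23.
- have [h|/ltW h] := leP (tag t1) (tag t3); [left|right]; exists h.
    by rewrite -E12 -(rep_mapE h12 h h23).
  by rewrite -E23 -(rep_mapE h23 h h12).
- right; have h := le_trans h23 h12; exists h.
  by rewrite (rep_mapE h23 h12) E23.
Qed.

Lemma joined_level k (x y : M k) :
  joined (Tagged (fun k => M k) x) (Tagged (fun k => M k) y) -> x = y.
Proof. by case=> -[h /=]; rewrite rep_map1. Qed.

(** A canonical representative of the class of t under [joined]. Indexing by
    all of T and giving the value 0 to the elements that are not their own
    representative avoids a quotient type. *)
Definition root (t : T) : T :=
  choose (fun t' => `[< on_basis t' /\ joined t t' >]) t.

Lemma rootP t : on_basis t -> on_basis (root t) /\ joined t (root t).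
Proof.
move=> tb; apply/asboolP/(@chooseP _ (fun t' => `[< on_basis t' /\ joined t t' >])).
by apply/asboolP; split=> //; apply: joined_refl.
Qed.

Lemma root_eq t t' : on_basis t -> on_basis t' -> joined t t' ->
  root t = root t'.
Proof.
move=> tb t'b tt'.
have E : (fun u => `[< on_basis u /\ joined t u >]) =1
         (fun u => `[< on_basis u /\ joined t' u >]).
  move=> u; apply/asboolP/asboolP => -[ub]; split=> //.
    by apply: joined_trans (joined_sym tt') _.
  exact: joined_trans tt' _.
rewrite /root (eq_choose E); apply: choose_id; apply/asboolP; split=> //.
  exact: joined_sym.
exact: joined_refl.
Qed.

Definition thread_through (t : T) (k : int) : M k :=
  xget 0 [set x | [/\ x \in b k, on_basis t, root t = t
                   & joined t (Tagged (fun k => M k) x)]].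

Lemma thread_throughE t k (x : M k) : x \in b k -> on_basis t ->
  root t = t -> joined t (Tagged (fun k => M k) x) -> thread_through t k = x.
Proof.
move=> xb tb rt tx; apply: xget_unique => // y [yb _ _ ty].
by apply: joined_level; apply: joined_trans (joined_sym ty) tx.
Qed.

Lemma thread_through_neq0 t k : thread_through t k != 0 ->
  [/\ thread_through t k \in b k, on_basis t, root t = t
    & joined t (Tagged (fun k => M k) (thread_through t k))].
Proof. by rewrite /thread_through; case: xgetP => [x -> []//|_ /eqP]. Qed.

Lemma thread_through_basis : thread_basis thread_through.
Proof.
split=> [t k n h /thread_through_neq0|k].
  set x := thread_through t k => -[xb tb rt tx].
  have [x0|x0] := eqVneq (rep_map M h x) 0; last first.
    apply/esym/thread_throughE => //; first exact: bl.
    apply: joined_trans tx _ => //; first exact: (bl (h := h)).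
    by left; exists h.
  rewrite x0; apply/esym/eqP; apply: contraTT isT => /thread_through_neq0.
  set y := thread_through t n => -[yb _ _ ty].
  have y0 := on_basis_neq0 (t := Tagged (fun k => M k) y) yb.
  have /= [[h' /= E]|[h' /= E]] := joined_trans (t1 := Tagged (fun k => M k) x)
    (t3 := Tagged (fun k => M k) y) xb tb yb (joined_sym tx) ty.
    by rewrite -E (bool_irrelevance h' h) x0 eqxx in y0.
  by rewrite -E -(rep_mapE h' h (lexx n)) rep_map1 in x0; rewrite /= x0 eqxx in y0.
have [bB _] := bG k; have b_uniq := free_uniq (basis_free bB).
have throughE x : x \in b k ->
    thread_through (root (Tagged (fun k => M k) x)) k = x.
  move=> xb; have [rb rx] := rootP (t := Tagged (fun k => M k) x) xb.
  apply: thread_throughE => //; last exact: joined_sym.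
  by apply/esym/root_eq.
exists [seq root (Tagged (fun k => M k) x) | x <- b k]; split.
- rewrite map_inj_in_uniq // => x y xb yb xy.
  by rewrite -(throughE x) // xy throughE.
- move=> t; apply/mapP/idP => [[x xb ->]|].
    by rewrite throughE //; exact: (basis_not0 bB xb).
  move=> /thread_through_neq0[xb tb rt tx]; exists (thread_through t k) => //.
  rewrite -[LHS]rt; apply: (root_eq tb) => //.
- rewrite -map_comp (_ : map _ _ = b k) //.
  by rewrite -[RHS]map_id; apply/eq_in_map => x xb; exact: throughE.
Qed.

End Threads.

Lemma persistence_thread_basis :
  exists (I : choiceType) (v : I -> forall k, M k), thread_basis v.
Proof.
have [b [bG bl]] := linked_bases_exist.
by eexists; exists (thread_through b); apply: thread_through_basis; last exact: linked_step.
Qed.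

End LinkedBases.

(** * Bars are the nonempty convex sets of integers *)
Section Bars.
Implicit Types (I J : bar) (x y c : \bar int) (i j k n : int).
Local Open Scope ereal_scope.

Lemma barP I : [/\ bar_lo I != +oo, bar_hi I != -oo & bar_lo I <= bar_hi I].
Proof. by case/and3P: (valP I). Qed.

Lemma bar_exists x y : x != +oo -> y != -oo -> x <= y ->
  exists I, bar_lo I = x /\ bar_hi I = y.
Proof.
move=> xoo yoo xy.
have H : [&& (x, y).1 != +oo, (x, y).2 != -oo & (x, y).1 <= (x, y).2].
  by apply/and3P.
by exists (exist _ (x, y) H).
Qed.

(** An element that is as low as wanted, up to the lower end of the bar; this
    and [bar_high] allow infinite ends to be treated as finite ones. *)
Lemma bar_low I n : exists i, bar_set I i /\ (i%:E = bar_lo I \/ (i <= n)%R).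
Proof.
have [] := barP I; rewrite /bar_set /=.
case: (bar_lo I) => [a||] // _; case: (bar_hi I) => [b||] // _ ab.
- by exists a; rewrite lexx ab; split=> //; left.
- by exists a; rewrite lexx leey; split=> //; left.
- exists (Num.min n b); rewrite leNye lee_fin ge_min lexx orbT; split=> //.
  by right; rewrite ge_min lexx.
- by exists n; rewrite leNye leey; split=> //; right.
Qed.

Lemma bar_high I n : exists i, bar_set I i /\ (i%:E = bar_hi I \/ (n <= i)%R).
Proof.
have [] := barP I; rewrite /bar_set /=.
case: (bar_lo I) => [a||] // _; case: (bar_hi I) => [b||] // _ ab.
- by exists b; rewrite lexx ab; split=> //; left.
- exists (Num.max n a); rewrite leey lee_fin le_max lexx orbT; split=> //.
  by right; rewrite le_max lexx.
- by exists b; rewrite leNye lexx; split=> //; left.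
- by exists n; rewrite leNye leey; split=> //; right.
Qed.

Lemma bar_set_nonempty I : bar_set I !=set0.
Proof. by have [i [Ii _]] := bar_low I 0%R; exists i. Qed.

(** With [bar_hi_le], turns an inequality between ends of bars into
    inequalities between integers. *)
Lemma le_bar_lo c I : (forall i, bar_set I i -> c <= i%:E) -> c <= bar_lo I.
Proof.
move=> cI; case: c cI => [a||] cI; last exact: leNye.
  have [i [Ii [<-|ia]]] := bar_low I (a - 1)%R; first exact: cI.
  by have := cI _ Ii; rewrite lee_fin; lia.
by have [i [Ii _]] := bar_low I 0%R; have := cI _ Ii.
Qed.

Lemma bar_hi_le c I : (forall i, bar_set I i -> i%:E <= c) -> bar_hi I <= c.
Proof.
move=> cI; case: c cI => [a||] cI; last 1 first.
- by have [i [Ii _]] := bar_low I 0%R; have := cI _ Ii.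
- have [i [Ii [<-|ia]]] := bar_high I (a + 1)%R; first exact: cI.
  by have := cI _ Ii; rewrite lee_fin; lia.
- exact: leey.
Qed.

Lemma bar_set_inj : injective bar_set.
Proof.
have sub I J : bar_set I = bar_set J -> bar_lo I <= bar_lo J /\ bar_hi J <= bar_hi I.
  move=> IJ; split; [apply: le_bar_lo|apply: bar_hi_le] => i.
    by rewrite -IJ => /andP[].
  by rewrite -IJ => /andP[].
move=> I J IJ; have [lo1 hi1] := sub _ _ IJ; have [lo2 hi2] := sub _ _ (esym IJ).
apply: val_inj; rewrite [LHS]surjective_pairing [RHS]surjective_pairing.
by congr (_, _); apply/le_anti; [rewrite [X in X && _]lo1 | rewrite [X in X && _]hi2].
Qed.

Lemma bar_set_convex I : convex_subset (bar_set I).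
Proof.
move=> i j k /andP[li ih] /andP[lk kh] ij jk; apply/andP; split.
  by apply: le_trans li _; rewrite lee_fin.
by apply: le_trans kh; rewrite lee_fin.
Qed.

End Bars.

Section ConvexIntegerSets.
Implicit Types (S : set int).

Lemma int_bounded_min S (n : int) : (forall i, S i -> n <= i) -> S !=set0 ->
  exists2 a, S a & forall i, S i -> a <= i.
Proof.
move=> nS [i0 Si0].
have ex : exists k : nat, `[< S (n + k%:Z) >].
  exists `|i0 - n|%N; apply/asboolP; have := nS _ Si0 => ni.
  by rewrite gez0_abs ?subr_ge0 // subrKC.
case: (ex_minnP ex) => k /asboolP Sk kmin; exists (n + k%:Z) => // i Si.
have ni := nS _ Si.
have /kmin : `[< S (n + `|i - n|%N%:Z) >].
  by apply/asboolP; rewrite gez0_abs ?subr_ge0 // subrKC.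
lia.
Qed.

Lemma int_bounded_max S (n : int) : (forall i, S i -> i <= n) -> S !=set0 ->
  exists2 a, S a & forall i, S i -> i <= a.
Proof.
move=> nS [i0 Si0].
have [i Si||a Sa amin] := @int_bounded_min [set i | S (- i)] (- n).
- by have := nS _ Si; lia.
- by exists (- i0); rewrite /= opprK.
- exists (- a) => // i Si; suff : a <= - i by lia.
  by apply: amin; rewrite /= opprK.
Qed.

Lemma convex_bar S : convex_subset S -> S !=set0 -> exists I, bar_set I = S.
Proof.
move=> S_convex S0; have [i0 Si0] := S0.
have [x [xoo xP]] : exists x : \bar int, x != +oo%E /\
    forall i, (x <= i%:E)%E <-> exists2 j, S j & j <= i.
  have [[n nS]|unb] := pselect (exists n, forall i, S i -> n <= i).
    have [a Sa amin] := int_bounded_min nS S0.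
    exists a%:E; split=> // i; rewrite lee_fin; split=> [ai|[j Sj ji]].
      by exists a.
    by apply: le_trans ji; apply: amin.
  exists -oo%E; split=> // i; rewrite leNye; split=> // _.
  apply: contrapT => nj; apply: unb; exists i => j Sj; rewrite leNgt.
  by apply/negP => ji; apply: nj; exists j => //; apply: ltW.
have [y [yoo yP]] : exists y : \bar int, y != -oo%E /\
    forall i, (i%:E <= y)%E <-> exists2 j, S j & i <= j.
  have [[n nS]|unb] := pselect (exists n, forall i, S i -> i <= n).
    have [a Sa amax] := int_bounded_max nS S0.
    exists a%:E; split=> // i; rewrite lee_fin; split=> [ai|[j Sj ji]].
      by exists a.
    by apply: le_trans ji _; apply: amax.
  exists +oo%E; split=> // i; rewrite leey; split=> // _.
  apply: contrapT => nj; apply: unb; exists i => j Sj; rewrite leNgt.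
  by apply/negP => ji; apply: nj; exists j => //; apply: ltW.
have [|I [Ix Iy]] := bar_exists xoo yoo.
  by apply: (@le_trans _ _ i0%:E); [apply/xP|apply/yP]; exists i0.
exists I; apply/seteqP; split=> i; rewrite /bar_set /= Ix Iy.
  by move=> /andP[/xP[j Sj ji] /yP[k Sk ik]]; apply: S_convex Sj Sk ji ik.
by move=> Si; apply/andP; split; [apply/xP|apply/yP]; exists i.
Qed.

End ConvexIntegerSets.

(** * Intervals of the shoelace *)
Section Connectedness.
Context {d : Order.disp_t} {P : preorderType d}.

Definition comparable (p q : P) : Prop := (p <= q)%O \/ (q <= p)%O.

Lemma connected_hub (S : set P) (z : P) : S z ->
    (forall p, S p -> exists2 q, S q & comparable z q /\ comparable q p) ->
  connected_subset S.
Proof.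
move=> Sz hub S1 S2 SE S12 sep.
have sep1 p q : S1 p -> comparable p q -> S q -> S1 q.
  move=> S1p pq; rewrite SE => -[//|S2q]; have [npq nqp] := sep _ _ S1p S2q.
  by case: pq.
have sep2 p q : S2 p -> comparable p q -> S q -> S2 q.
  move=> S2p pq; rewrite SE => -[S1q|//]; have [npq nqp] := sep _ _ S1q S2p.
  by case: pq.
have disj p : S1 p -> S2 p -> False.
  by move=> S1p S2p; have : (S1 `&` S2) p by []; rewrite S12.
move: (Sz); rewrite [X in X z]SE => -[S1z|S2z]; [right|left];
    apply/seteqP; split=> // p Sp.
  have Sp' : S p by rewrite SE; right.
  have [q Sq [zq qp]] := hub p Sp'; apply: disj Sp.
  exact: sep1 (sep1 _ _ S1z zq Sq) qp Sp'.
have Sp' : S p by rewrite SE; left.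
have [q Sq [zq qp]] := hub p Sp'; apply: (disj _ Sp).
exact: sep2 (sep2 _ _ S2z zq Sq) qp Sp'.
Qed.

Lemma connected_total (S : set P) :
  (forall p q, S p -> S q -> comparable p q) -> connected_subset S.
Proof.
move=> tot; have [[z Sz]|S0] := pselect (S !=set0).
  apply: (connected_hub Sz) => p Sp; exists p => //; split; first exact: tot.
  by left.
move=> S1 S2 SE _ _; left; apply/seteqP; split=> // p S1p.
by case: S0; exists p; rewrite SE; left.
Qed.

Lemma connected_comparable (S A B : set P) : connected_subset S ->
    S = A `|` B -> A !=set0 -> B !=set0 -> A `&` B = set0 ->
  exists p q, [/\ A p, B q & comparable p q].
Proof.
move=> Sc SE A0 B0 AB; apply: contrapT => nex.
have [|A0'|B0'] := Sc A B SE AB.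
- move=> p q Ap Bq; split=> pq; apply: nex; exists p, q; split=> //; first by left.
  by right.
- by rewrite A0' in A0; case: A0.
- by rewrite B0' in B0; case: B0.
Qed.

End Connectedness.

Section Codes.
Variable eps : nat.
Implicit Types (I J : bar) (i j k n : int).

(** A convex set of the shoelace, described by its traces on the left and on the
    right copy of Z; None stands for an empty trace. *)
Definition code : Type := (option bar * option bar)%type.
HB.instance Definition _ := Choice.on code.

Definition opt_bar_set (o : option bar) : set int :=
  if o is Some b then bar_set b else set0.

Definition code_set (p : code) : set (shoelace eps) :=
  fun z =>
    match z with inl i => opt_bar_set p.1 i | inr j => opt_bar_set p.2 j end.

Lemma opt_bar_set_inj : injective opt_bar_set.
Proof.
move=> [I|] [J|] //= IJ; first by rewrite (bar_set_inj IJ).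
  by have [i] := bar_set_nonempty I; rewrite IJ.
by have [i] := bar_set_nonempty J; rewrite -IJ.
Qed.

Lemma opt_bar_set_exists (S : set int) : convex_subset S ->
  exists o, opt_bar_set o = S.
Proof.
move=> Sc; have [S0|S0] := pselect (S !=set0).
  by have [I IS] := convex_bar Sc S0; exists (Some I).
exists None; apply/seteqP; split=> // i Si; case: S0; by exists i.
Qed.

Lemma code_set_inj : injective code_set.
Proof.
move=> [o1 o2] [o1' o2'] pp'; congr (_, _); apply: opt_bar_set_inj.
  by apply/funext => i; apply: (congr1 (fun S => S (inl i)) pp').
by apply/funext => i; apply: (congr1 (fun S => S (inr i)) pp').
Qed.

Lemma code_set_exists (S : set (shoelace eps)) : convex_subset S ->
  exists p, code_set p = S.
Proof.
move=> Sc.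
have [|o1 o1E] := @opt_bar_set_exists [set i | S (inl i)].
  by move=> i j k; exact: (Sc (inl i) (inl j) (inl k)).
have [|o2 o2E] := @opt_bar_set_exists [set i | S (inr i)].
  by move=> i j k; exact: (Sc (inr i) (inr j) (inr k)).
by exists (o1, o2); apply/funext => -[i|i] /=; rewrite ?o1E ?o2E.
Qed.

(** Exchanging the two copies of Z is an automorphism of the shoelace. *)
Lemma code_set_flip o o' : interval_subset (code_set (o, o')) ->
  interval_subset (code_set (o', o)).
Proof.
pose flip (z : shoelace eps) : shoelace eps :=
  match z with inl i => inr i | inr i => inl i end.
have flipK z : flip (flip z) = z by case: z.
have flip_le p q : (flip p <= flip q)%O = (p <= q)%O by case: p; case: q.
have flipE z : code_set (o', o) (flip z) = code_set (o, o') z by case: z.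
move=> [conn conv]; split.
  move=> S1 S2 SE S12 sep.
  have [||p q /= S1p S2q|S0|S0] := conn (S1 \o flip) (S2 \o flip).
  - by apply/funext => z; rewrite -flipE SE.
  - by apply/seteqP; split=> // z [S1z S2z]; have : (S1 `&` S2) (flip z) by []; rewrite S12.
  - by have := sep _ _ S1p S2q; rewrite !flip_le.
  - left; apply/seteqP; split=> // z S1z.
    by have : set0 (flip z) by rewrite -S0 /= flipK.
  - right; apply/seteqP; split=> // z S2z.
    by have : set0 (flip z) by rewrite -S0 /= flipK.
move=> p q r; have := conv (flip p) (flip q) (flip r).
by rewrite !flip_le -!flipE !flipK.
Qed.

Lemma bar_shortP I :
  bar_short eps I <-> forall i j, bar_set I i -> bar_set I j -> j < i + (2 * eps)%:Z.
Proof.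
rewrite /bar_short /bar_set /=; have [] := barP I.
case xE: (bar_lo I) => [a||] // _; case yE: (bar_hi I) => [b||] // _ ab /=.
- rewrite lte_fin; rewrite lee_fin in ab; split=> [s i j|short].
    by rewrite !lee_fin; lia.
  have := short a b; rewrite !lee_fin lexx ab lexx => /(_ isT isT); lia.
- split=> // short; have := short a (a + (2 * eps)%:Z).
  by rewrite !leey !lee_fin lexx => /(_ isT); lia.
- split=> // short; have := short (b - (2 * eps)%:Z) b.
  by rewrite !leNye !lee_fin lexx => /(_ _ isT); lia.
- split=> // short; have := short 0 (2 * eps)%:Z.
  by rewrite !leNye !leey => /(_ isT isT); lia.
Qed.

(** A right element between left elements i and j exists iff
    i + 2 eps <= j. *)
Lemma interval_code_left I :
  interval_subset (code_set (Some I, None)) <-> bar_short eps I.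
Proof.
rewrite bar_shortP; split=> [[_ conv] i j Ii Ij|short].
  rewrite ltNge; apply/negP => ij.
  have ij' : i + eps%:Z + eps%:Z <= j by lia.
  by have := conv (inl i) (inr (i + eps%:Z)) (inl j) Ii Ij (lexx _) ij'.
split.
  apply: connected_total => -[i|//] [j|//] _ _.
  by have [ij|/ltW ji] := leP i j; [left|right].
move=> [i|//] z [j|//] Ii Ij; case: z => k ik kj /=.
  exact: (bar_set_convex Ii Ij).
by have := short i j Ii Ij; have : i + eps%:Z <= k by []; have : k + eps%:Z <= j by []; lia.
Qed.

(** The first four inequalities say that corresponding ends are at distance at
    most eps, the last one that the bars contain comparable elements. *)
Definition compatible I J : Prop :=
  let e := ((eps%:Z)%:E)%E in
  [/\ bar_lo J - e <= bar_lo I, bar_lo I - e <= bar_lo J,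
      bar_hi J - e <= bar_hi I, bar_hi I - e <= bar_hi J
    & bar_lo I <= bar_hi J - e \/ bar_lo J <= bar_hi I - e]%E.

(** Let i on the left lie below k on the right. Then convexity moves elements of
    one bar by eps into the other: an element a of I gives a + eps in J if
    a <= i, and a - eps in J if k + eps <= a; an element a of J gives a - eps
    in I if k <= a, and a + eps in I if a + eps <= i. *)
Lemma compatible_of_interval I J :
  interval_subset (code_set (Some I, Some J)) -> compatible I J.
Proof.
have half I' J' i k : convex_subset (code_set (Some I', Some J')) ->
    bar_set I' i -> bar_set J' k -> i + eps%:Z <= k ->
    let e := ((eps%:Z)%:E)%E in
    [/\ bar_lo J' - e <= bar_lo I', bar_lo I' - e <= bar_lo J',
      bar_hi J' - e <= bar_hi I', bar_hi I' - e <= bar_hi J'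
    & bar_lo I' <= bar_hi J' - e]%E.
  move=> conv I'i J'k ik; cbv zeta.
  have ll (i1 i2 i3 : int) : bar_set I' i1 -> bar_set I' i3 -> i1 + eps%:Z <= i2 ->
      i2 + eps%:Z <= i3 -> bar_set J' i2.
    by move=> h1 h3; exact: (conv (inl i1) (inr i2) (inl i3) h1 h3).
  have rr (i1 i2 i3 : int) : bar_set J' i1 -> bar_set I' i3 -> i1 + eps%:Z <= i3 ->
      i1 <= i2 -> i2 + eps%:Z <= i3 -> bar_set J' i2.
    by move=> h1 h3 _; exact: (conv (inr i1) (inr i2) (inl i3) h1 h3).
  have rl (i1 i2 i3 : int) : bar_set J' i1 -> bar_set I' i3 ->
      i1 + eps%:Z <= i2 -> i2 <= i3 -> bar_set I' i2.
    by move=> h1 h3; exact: (conv (inr i1) (inl i2) (inl i3) h1 h3).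
  have lr (i1 i2 i3 : int) : bar_set I' i1 -> bar_set J' i3 ->
      i1 + eps%:Z <= i2 -> i2 <= i3 -> bar_set J' i2.
    by move=> h1 h3; exact: (conv (inl i1) (inr i2) (inr i3) h1 h3).
  have lr' (i1 i2 i3 : int) : bar_set I' i1 -> bar_set J' i3 ->
      i1 <= i2 -> i2 + eps%:Z <= i3 -> bar_set I' i2.
    by move=> h1 h3; exact: (conv (inl i1) (inl i2) (inr i3) h1 h3).
  have lo c : bar_set I' c -> (bar_lo I' <= c%:E)%E by case/andP.
  have hi c : bar_set I' c -> (c%:E <= bar_hi I')%E by case/andP.
  have lo' c : bar_set J' c -> (bar_lo J' <= c%:E)%E by case/andP.
  have hi' c : bar_set J' c -> (c%:E <= bar_hi J')%E by case/andP.
  have weak (a b : int) (x : \bar int) : (x <= a%:E)%E -> a <= b -> (x <= b%:E)%E.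
    by move=> xa ab; apply: le_trans xa _; rewrite lee_fin.
  have weak' (a b : int) (x : \bar int) : (a%:E <= x)%E -> b <= a -> (b%:E <= x)%E.
    by move=> xa ab; apply: le_trans xa; rewrite lee_fin.
  split.
  - apply: le_bar_lo => a Ia; rewrite leeBlDr // -EFinD.
    have [ai|/ltW ia] := leP a i.
      by apply: lo'; apply: lr Ia J'k _ _ => //; lia.
    by apply: (weak (i + eps%:Z)); [apply: lo'; apply: lr I'i J'k _ _; lia|lia].
  - apply: le_bar_lo => a Ja; rewrite leeBlDr // -EFinD.
    have [ai|ia] := leP (a + eps%:Z) i; first by apply: lo; apply: rl Ja I'i _ ai.
    by apply: (weak i); [apply: lo|lia].
  - rewrite leeBlDr //; apply: bar_hi_le => a Ja; rewrite -leeBlDr // -EFinB.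
    have [ka|/ltW ak] := leP k a.
      by apply: hi; apply: lr' I'i Ja _ _; lia.
    by apply: (weak' (k - eps%:Z)); [apply: hi; apply: lr' I'i J'k _ _; lia|lia].
  - rewrite leeBlDr //; apply: bar_hi_le => a Ia; rewrite -leeBlDr // -EFinB.
    have [ka|ak] := leP (k + eps%:Z) a.
      by apply: hi'; apply: rr J'k Ia (ka) _ _; lia.
    by apply: (weak' k); [apply: hi'|lia].
  - rewrite leeBrDr //; apply: le_trans (hi' _ J'k).
    by rewrite -leeBrDr // -EFinB; apply: (weak i); [apply: lo|lia].
move=> IJ; have [conn conv] := IJ.
have [a Ia] := bar_set_nonempty I; have [c Jc] := bar_set_nonempty J.
have [||||z [w [zI wJ zw]]] := connected_comparable
    (A := fun z : shoelace eps => if z is inl i then bar_set I i else False)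
    (B := fun z : shoelace eps => if z is inr i then bar_set J i else False) conn.
- by apply/seteqP; split=> -[z|z] //=; [left|right|case|case].
- by exists (inl a).
- by exists (inr c).
- by apply/seteqP; split=> // -[z|z] [].
case: z zI zw => // i Ii; case: w wJ => // k Jk [] ik.
  by have [h1 h2 h3 h4 h5] := half I J i k conv Ii Jk ik; split=> //; left.
have [_ conv'] := code_set_flip IJ.
by have [h1 h2 h3 h4 h5] := half J I k i conv' Jk Ii ik; split=> //; right.
Qed.

(** An element above an element of J in the other copy is above the lower end of
    I. With its dual this gives the convexity of compatible pairs. *)
Lemma lo_after I J j a : (bar_lo I - ((eps%:Z)%:E) <= bar_lo J)%E ->
  bar_set J j -> j + eps%:Z <= a -> (bar_lo I <= a%:E)%E.
Proof.
move=> IJ /andP[lj _] ja; apply: le_trans (_ : (j + eps%:Z)%:E <= _)%E.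
  by rewrite EFinD -leeBlDr //; apply: le_trans lj.
by rewrite lee_fin.
Qed.

Lemma hi_before I J j a : (bar_hi J - ((eps%:Z)%:E) <= bar_hi I)%E ->
  bar_set J j -> a + eps%:Z <= j -> (a%:E <= bar_hi I)%E.
Proof.
move=> JI /andP[_ jh] aj; apply: le_trans JI.
by rewrite leeBrDr // -EFinD; apply: le_trans jh; rewrite lee_fin.
Qed.

(** Otherwise j < i + eps for all i in I and j in J, so the end of J is finite
    and lies at least one step too low; this uses that the ends are integers. *)
Lemma meeting_points I J : (bar_lo I <= bar_hi J - ((eps%:Z)%:E))%E ->
  exists i j, [/\ bar_set I i, bar_set J j & i + eps%:Z <= j].
Proof.
move=> IJ; apply: contrapT => nex.
have far i j : bar_set I i -> bar_set J j -> j < i + eps%:Z.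
  move=> Ii Jj; rewrite ltNge; apply/negP => ij; apply: nex.
  by exists i, j.
have [i Ii] := bar_set_nonempty I.
have hiJ : (bar_hi J + 1%:E - ((eps%:Z)%:E) <= bar_lo I)%E.
  apply: le_bar_lo => i1 Ii1; rewrite leeBlDr // -leeBrDr //.
  apply: bar_hi_le => j Jj; have := far _ _ Ii1 Jj.
  by rewrite leeBrDr // -!EFinD lee_fin; lia.
have := le_trans hiJ IJ; rewrite leeBrDr //.
have : (bar_hi J <= (i + eps%:Z)%:E)%E.
  by apply: bar_hi_le => j Jj; rewrite lee_fin ltW // far.
have [_ + _] := barP J; case: (bar_hi J) => [b||] // _ _.
by rewrite !lee_fin; lia.
Qed.

Lemma interval_of_compatible I J :
  compatible I J -> interval_subset (code_set (Some I, Some J)).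
Proof.
move=> [lo1 lo2 hi1 hi2 meet]; split; last first.
  have low (z : shoelace eps) a : code_set (Some I, Some J) z ->
      (z <= (inl a : shoelace eps))%O -> (bar_lo I <= a%:E)%E.
    case: z => j Sj ja; last exact: lo_after lo2 Sj ja.
    by case/andP: Sj => + _; move/le_trans; apply; rewrite lee_fin.
  have low' (z : shoelace eps) a : code_set (Some I, Some J) z ->
      (z <= (inr a : shoelace eps))%O -> (bar_lo J <= a%:E)%E.
    case: z => j Sj ja; first exact: lo_after lo1 Sj ja.
    by case/andP: Sj => + _; move/le_trans; apply; rewrite lee_fin.
  have high (z : shoelace eps) a : code_set (Some I, Some J) z ->
      ((inl a : shoelace eps) <= z)%O -> (a%:E <= bar_hi I)%E.
    case: z => j Sj ja; last exact: hi_before hi1 Sj ja.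
    by case/andP: Sj => _; apply: le_trans; rewrite lee_fin.
  have high' (z : shoelace eps) a : code_set (Some I, Some J) z ->
      ((inr a : shoelace eps) <= z)%O -> (a%:E <= bar_hi J)%E.
    case: z => j Sj ja; first exact: hi_before hi2 Sj ja.
    by case/andP: Sj => _; apply: le_trans; rewrite lee_fin.
  move=> p [a|a] r Sp Sr pa ar; apply/andP; split.
  - exact: low Sp pa.
  - exact: high Sr ar.
  - exact: low' Sp pa.
  - exact: high' Sr ar.
have tot i j : comparable (inl i : shoelace eps) (inl j).
  by have [ij|/ltW ji] := leP i j; [left|right].
have tot' i j : comparable (inr i : shoelace eps) (inr j).
  by have [ij|/ltW ji] := leP i j; [left|right].
have [i [j [Ii Jj ij]]] : exists i j, [/\ bar_set I i, bar_set J j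
    & comparable (inl i : shoelace eps) (inr j)].
  case: meet => /meeting_points[i [j [Ii Jj ij]]].
    by exists i, j; split=> //; left.
  by exists j, i; split=> //; right.
apply: (@connected_hub _ (shoelace eps) _ (inl i : shoelace eps)) => // -[k|k] Sk.
  by exists (inl k) => //; split; exact: tot.
by exists (inr j).
Qed.

Lemma endpoint_distP x y :
  (endpoint_dist x y <= (eps%:Z)%:E)%E <->
  (x - ((eps%:Z)%:E) <= y)%E /\ (y - ((eps%:Z)%:E) <= x)%E.
Proof.
case: x => [a||]; case: y => [b||] //=; rewrite ?leey ?leNye;
  try by split=> // -[].
rewrite !lee_fin ler_distlC; split=> [/andP[]|[]]; last by lia.
by split; lia.
Qed.

Lemma compatible_dist I J : compatible I J ->
  (endpoint_dist (bar_lo I) (bar_lo J) <= (eps%:Z)%:E)%E /\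
  (endpoint_dist (bar_hi I) (bar_hi J) <= (eps%:Z)%:E)%E.
Proof. by case=> lo1 lo2 hi1 hi2 _; rewrite !endpoint_distP. Qed.

(** For i and i + 2 eps in I, the element i + eps is between the lower end of I
    plus eps and the upper end of J. *)
Lemma long_reaches I J : (bar_hi I - ((eps%:Z)%:E) <= bar_hi J)%E ->
  ~ bar_short eps I -> (bar_lo I <= bar_hi J - ((eps%:Z)%:E))%E.
Proof.
move=> IJ; rewrite bar_shortP => long.
have [i [j [Ii Ij ij]]] : exists i j, [/\ bar_set I i, bar_set I j
    & i + (2 * eps)%:Z <= j].
  apply: contrapT => nex; apply: long => i j Ii Ij; rewrite ltNge; apply/negP => ij.
  by apply: nex; exists i, j.
have li : (bar_lo I <= i%:E)%E by case/andP: Ii.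
apply: (le_trans li); rewrite leeBrDr // -EFinD.
by apply: hi_before IJ Ij _; lia.
Qed.

Lemma compatible_of_essential I J :
  (endpoint_dist (bar_lo I) (bar_lo J) <= (eps%:Z)%:E)%E ->
  (endpoint_dist (bar_hi I) (bar_hi J) <= (eps%:Z)%:E)%E ->
  (bar_short eps I -> bar_short eps J ->
    (bar_lo I <= bar_hi J - (eps%:Z)%:E)%E \/
    (bar_lo J <= bar_hi I - (eps%:Z)%:E)%E) ->
  compatible I J.
Proof.
rewrite !endpoint_distP => -[lo1 lo2] [hi1 hi2] short; split=> //.
have [sI|lI] := pselect (bar_short eps I); last by left; apply: long_reaches.
have [sJ|lJ] := pselect (bar_short eps J); last by right; apply: long_reaches.
exact: short.
Qed.

End Codes.

(** * Counting threads *)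
Section Counting.

Lemma count_tag (C : choiceType) (m : C -> nat) (r : seq {c : C & 'I_(m c)}) c :
    uniq r -> (forall t, tag t = c -> t \in r) ->
  count (fun t => tag t == c) r = m c.
Proof.
move=> r_uniq rc; rewrite -size_filter -(size_fiber m c); apply/perm_size.
apply: uniq_perm; rewrite ?filter_uniq ?fiber_uniq // => t.
by rewrite mem_filter mem_fiber; case: eqP => //= /rc.
Qed.

(** With h sending o to the code whose left (or right) trace is a given bar and
    whose other trace is o, this counts the threads with the given trace. *)
Lemma size_fibers (X C : choiceType) (m : C -> nat) (h : option X -> C)
    (r : seq {c : C & 'I_(m c)}) :
    injective h -> uniq r -> (forall t, t \in r <-> exists o, h o = tag t) ->
  finite_set [set x | m (h (Some x)) != 0%N] /\
  size r = (m (h None) + \big[addn/0%N]_(x \in [set: X]) m (h (Some x)))%N.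
Proof.
move=> h_inj r_uniq rP.
pose D := undup (pmap (fun t => xget None [set o | h o = tag t]) r).
have tagE (t : {c : C & 'I_(m c)}) o : h o = tag t -> xget None [set o | h o = tag t] = o.
  by move=> ho; apply: xget_unique => // o' /= ho'; apply: h_inj; rewrite ho'.
have memD (t : {c : C & 'I_(m c)}) x : h (Some x) = tag t -> x \in D.
  move=> hx; rewrite mem_undup mem_pmap; apply/mapP; exists t.
    by apply/rP; exists (Some x).
  by rewrite (tagE _ _ hx).
have m0 x : x \notin D -> m (h (Some x)) = 0%N.
  move=> xD; apply/eqP; rewrite -leqn0 leqNgt; apply: contra xD => m_gt0.
  by apply: (@memD (Tagged (fun c => 'I_(m c)) (Ordinal m_gt0))).
split.
  apply: (@sub_finite_set _ _ [set` D]); last exact: finite_seq.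
  by move=> x /=; apply: contraR => /m0 ->.
have D_uniq : uniq D by apply: undup_uniq.
rewrite (fsbigT_seq _ D_uniq m0).
have cnt o : m (h o) = count (fun t => tag t == h o) r.
  by rewrite count_tag // => t to; apply/rP; exists o.
rewrite cnt; under eq_bigr do rewrite cnt.
under eq_bigr do rewrite -sum1_count big_mkcond /=.
rewrite exchange_big /= -sum1_count big_mkcond -big_split /= -sum1_size.
apply: eq_big_seq => t /rP[[x|] hx]; rewrite -hx (inj_eq h_inj).
  rewrite (bigD1_seq x) //=; last exact: memD hx.
  rewrite eqxx big1 // => y yx; rewrite (inj_eq h_inj) ifN //.
  by apply: contra yx => /eqP[->].
by rewrite eqxx big1 // => y _; rewrite (inj_eq h_inj).
Qed.

Lemma leq_fsbig_term (X : choiceType) (F : X -> nat) x :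
  finite_set [set x | F x != 0%N] -> (F x <= \big[addn/0%N]_(y \in [set: X]) F y)%N.
Proof.
move=> /finite_seqP[s sE].
have F0 y : y \notin undup s -> F y = 0%N.
  rewrite mem_undup => ys; apply/eqP; apply: contraNT ys => Fy.
  by have : [set` s] y by rewrite -sE.
rewrite (fsbigT_seq _ (undup_uniq s) F0).
have [xs|/F0 ->//] := boolP (x \in undup s).
by rewrite (bigD1_seq x) ?undup_uniq //= leq_addr.
Qed.

End Counting.

(** * Barcodes and restrictions *)
Section Barcodes.
Context {K : fieldType}.
Implicit Types (M : persistence_module K) (B : bar_multiset).

Lemma connected_int (S : set int) : connected_subset S.
Proof.
by apply: connected_total => i j _ _; have [ij|/ltW ji] := leP i j; [left|right].
Qed.

Lemma is_barcodeE M B : is_barcode M B <-> decomposes M bar_set B.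
Proof.
split=> [[V [VI VM]]|dec].
  have [v [vB vS]] := thread_basis_of_direct_sum (fun t => (VI t).1) VM.
  by exists v; split=> // t; rewrite vS; exact: (VI t).2.
by apply: decomposes_interval_rep => // I _; apply: connected_int.
Qed.

Lemma decomposes_barcode M : decomposes M bar_set (barcode M).
Proof.
apply/is_barcodeE; rewrite /barcode; apply: xgetPex.
have [I [v vB]] := persistence_thread_basis M.
have [|B [dec _ _]] := decomposes_of_thread_basis vB bar_set_inj; last by exists B; apply/is_barcodeE.
by move=> i; apply: convex_bar; apply: convex_thread_supp; exact: vB.1.
Qed.

Lemma barcodeE M B : decomposes M bar_set B -> barcode M = B.
Proof.
move=> dec; apply/funext => I.
apply: (decomposes_unique bar_set_inj _ _ (decomposes_barcode M) dec).
- by move=> J _; apply: connected_int.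
- by move=> J _; apply: connected_int.
- exact: bar_set_nonempty.
Qed.

End Barcodes.

Section Restriction.
Context {K : fieldType}.

Lemma thread_basis_restrict (d d' : Order.disp_t) (P : preorderType d)
    (Q : preorderType d') (f : P -> Q)
    (f_mono : forall x y : P, (x <= y)%O -> (f x <= f y)%O) (L : rep K Q)
    (I : choiceType) (v : I -> forall q, L q) :
  thread_basis v ->
  thread_basis (fun i p => v i (f p) : Defs.restrict f_mono L p).
Proof.
move=> vB; split=> [i p q h vp|p]; first exact: vB.1.
exact: vB.2.
Qed.

(** A thread basis of L restricts to one of its restriction. The threads with
    trace I are those whose code is h I o for some o. *)
Lemma decomposes_restrict (eps : nat) (f : int -> shoelace eps)
    (f_mono : forall i j : int, (i <= j)%O -> (f i <= f j)%O)
    (proj : code -> option bar) (h : bar -> option bar -> code)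
    (L : rep K (shoelace eps)) (m : code -> nat) :
    (forall p i, code_set p (f i) = opt_bar_set (proj p) i) ->
    (forall I, injective (h I)) ->
    (forall I p, proj p = Some I <-> exists o, h I o = p) ->
    decomposes L (@code_set eps) m ->
  (forall I, finite_set [set J | m (h I (Some J)) != 0%N]) /\
  decomposes (Defs.restrict f_mono L) bar_set
    (fun I => m (h I None) +
       \big[addn/0%N]_(J \in [set: bar]) m (h I (Some J)))%N.
Proof.
move=> fE h_inj hE [v [vB vS]].
have v'B := thread_basis_restrict f_mono vB.
have v'S t : thread_supp (fun i => v t (f i) : Defs.restrict f_mono L i) =
    opt_bar_set (proj (tag t)).
  by apply/funext => i; rewrite -fE -vS.
have [|m' [dec _ m'E]] := decomposes_of_thread_basis v'B bar_set_inj.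
  move=> t t0; apply: convex_bar t0; apply: convex_thread_supp; exact: v'B.1.
have count I : finite_set [set J | m (h I (Some J)) != 0%N] /\ m' I =
    (m (h I None) + \big[addn/0%N]_(J \in [set: bar]) m (h I (Some J)))%N.
  have [r [r_uniq <- rE]] := m'E I (bar_set_nonempty I).
  apply: size_fibers => // t; rewrite rE v'S -[bar_set I]/(opt_bar_set (Some I)).
  by split=> [/opt_bar_set_inj/hE//|/hE ->].
split=> [I|]; first exact: (count I).1.
have <- : m' = (fun I => m (h I None) +
       \big[addn/0%N]_(J \in [set: bar]) m (h I (Some J)))%N; last exact: dec.
by apply/funext => I; exact: (count I).2.
Qed.

Definition pairing (m : code -> nat) : pair_multiset :=
  fun I J => m (Some I, Some J).

Lemma decomposes_left (eps : nat) (L : rep K (shoelace eps)) (m : code -> nat) :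
    decomposes L (@code_set eps) m ->
  (forall I, finite_set [set J | pairing m I J != 0%N]) /\
  decomposes (restrict_left L) bar_set
    (fun I => m (Some I, None) + matched_l (pairing m) I)%N.
Proof.
apply: (@decomposes_restrict eps _ _ fst (fun I o => (Some I, o))) => //.
- by move=> I o o' [].
- by move=> I [o o'] /=; split=> [->|[? [<-]]//]; exists o'.
Qed.

Lemma decomposes_right (eps : nat) (L : rep K (shoelace eps)) (m : code -> nat) :
    decomposes L (@code_set eps) m ->
  (forall J, finite_set [set I | pairing m I J != 0%N]) /\
  decomposes (restrict_right L) bar_set
    (fun J => m (None, Some J) + matched_r (pairing m) J)%N.
Proof.
apply: (@decomposes_restrict eps _ _ snd (fun J o => (o, Some J))) => //.
- by move=> I o o' [].
- by move=> I [o o'] /=; split=> [->|[? [_ <-]]//]; exists o.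
Qed.

End Restriction.

(** * The correspondence *)
Section Correspondence.
Context {K : fieldType} {eps : nat}.
Implicit Types (M N : persistence_module K) (L : rep K (shoelace eps)).
Implicit Types (m : code -> nat) (u : pair_multiset).

(** The value at the code of the empty set is fixed to make m unique. *)
Definition has_codes L m : Prop :=
  [/\ decomposes L (@code_set eps) m,
      forall p, (0 < m p)%N -> interval_subset (@code_set eps p)
    & m (None, None) = 0%N].

Lemma code_set0 : @code_set eps (None, None) = set0.
Proof. by apply/seteqP; split=> // -[]. Qed.

Lemma code_set_nonempty (p : code) : p != (None, None) ->
  @code_set eps p !=set0.
Proof.
case: p => -[I|] [J|] // _; last first.
- by have [j Jj] := bar_set_nonempty J; exists (inr j).
- by have [i Ii] := bar_set_nonempty I; exists (inl i).
- by have [i Ii] := bar_set_nonempty I; exists (inl i).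
Qed.

Lemma has_codes_exists L : interval_decomposable L -> exists m, has_codes L m.
Proof.
move=> [I [V [VI VL]]]; have [v [vB vS]] := thread_basis_of_direct_sum VI VL.
have vI i : interval_subset (thread_supp (v i)) by rewrite vS; case: (VI i).
have [|m [dec m0 mE]] := decomposes_of_thread_basis vB (@code_set_inj eps).
  by move=> i _; apply: code_set_exists; case: (vI i).
exists m; split=> // [p m_gt0|]; last exact: m0 code_set0.
have [r [_ rm rE]] : exists r : seq I, [/\ uniq r, size r = m p
    & forall i, i \in r <-> thread_supp (v i) = @code_set eps p].
  apply: mE; apply/set0P; apply: contraTneq m_gt0 => /m0 ->.
  by rewrite ltnn.
case: r rm rE => [rm|i r _ rE]; first by rewrite -rm in m_gt0.
by have /rE <- : i \in i :: r by apply: mem_head.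
Qed.

Lemma has_codes_decomposable L m : has_codes L m -> interval_decomposable L.
Proof.
move=> [dec mI _].
have [V [VI VL]] := decomposes_interval_rep (fun p p0 => (mI p p0).1) dec.
by exists _, V; split=> // t; exact: (VI t).1.
Qed.

Lemma has_codes_unique L m m' : has_codes L m -> has_codes L m' -> m = m'.
Proof.
move=> [dec mI m0] [dec' m'I m'0]; apply/funext => p.
have [->|p0] := eqVneq p (None, None); first by rewrite m0 m'0.
apply: (decomposes_unique (@code_set_inj eps) _ _ dec dec').
- by move=> q /mI[].
- by move=> q /m'I[].
- exact: code_set_nonempty.
Qed.

Lemma has_codes_iso L L' m : rep_iso L L' -> has_codes L m -> has_codes L' m.
Proof. by move=> LL' [dec mI m0]; split=> //; apply: decomposes_transport dec. Qed.

Lemma barcode_left M L m : has_codes L m -> rep_iso (restrict_left L) M ->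
  forall I, barcode M I = (m (Some I, None) + matched_l (pairing m) I)%N.
Proof.
move=> [dec _ _] LM I; have [_ decl] := decomposes_left dec.
by rewrite (barcodeE (decomposes_transport LM decl)).
Qed.

Lemma barcode_right N L m : has_codes L m -> rep_iso (restrict_right L) N ->
  forall J, barcode N J = (m (None, Some J) + matched_r (pairing m) J)%N.
Proof.
move=> [dec _ _] LN J; have [_ decr] := decomposes_right dec.
by rewrite (barcodeE (decomposes_transport LN decr)).
Qed.

Lemma pairing_essential M N L m : has_codes L m ->
    rep_iso (restrict_left L) M -> rep_iso (restrict_right L) N ->
  essential_eps_matchings eps (barcode M) (barcode N) (pairing m).
Proof.
move=> Lm LM LN; have [dec mI m0] := Lm.
have [finl _] := decomposes_left dec; have [finr _] := decomposes_right dec.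
have compat I J : (0 < pairing m I J)%N -> compatible eps I J.
  by move=> /mI; apply: compatible_of_interval.
split; last first.
  move=> I J /compat[lo1 lo2 hi1 hi2 [meet|meet]] _ _; [left|right]; by [].
split; first split=> // [I|J].
- by rewrite (barcode_left Lm LM) leq_addl.
- by rewrite (barcode_right Lm LN) leq_addl.
- by move=> I J /compat/compatible_dist.
- move=> I; rewrite (barcode_left Lm LM) -subn_gt0 addnK => /mI.
  by rewrite interval_code_left.
- move=> J; rewrite (barcode_right Lm LN) -subn_gt0 addnK => /mI/code_set_flip.
  by rewrite interval_code_left.
Qed.

(** The barcodes of M and N determine the multiplicities of the intervals with
    a single trace, by subtraction. *)
Lemma same_pairing_iso M N L L' m m' : has_codes L m -> has_codes L' m' ->
    rep_iso (restrict_left L) M -> rep_iso (restrict_right L) N ->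
    rep_iso (restrict_left L') M -> rep_iso (restrict_right L') N ->
  pairing m = pairing m' -> rep_iso L L'.
Proof.
move=> Lm Lm' LM LN LM' LN' mm'.
suff E : m = m' by move: Lm Lm' => [dec _ _] [dec' _ _]; rewrite E in dec;
  exact: decomposes_iso dec dec'.
apply/funext => -[[I|] [J|]].
- exact: (congr1 (fun u => u I J) mm').
- apply: (@addIn (matched_l (pairing m) I)).
  by rewrite -(barcode_left Lm LM) mm' -(barcode_left Lm' LM').
- apply: (@addIn (matched_r (pairing m) J)).
  by rewrite -(barcode_right Lm LN) mm' -(barcode_right Lm' LN').
- by case: Lm Lm' => [_ _ ->] [_ _ ->].
Qed.

Definition matching_codes M N u : code -> nat := fun p =>
  match p with
  | (Some a, Some b) => u a b
  | (Some a, None) => (barcode M a - matched_l u a)%N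
  | (None, Some b) => (barcode N b - matched_r u b)%N
  | (None, None) => 0%N
  end.

Lemma barcode_fin M (i : int) : exists r : seq bar,
  forall I, (0 < barcode M I)%N -> bar_set I i -> I \in r.
Proof.
have [v [vB vS]] := decomposes_barcode M; have [s [_ sE _]] := vB.2 i.
exists (map tag s) => I I_gt0 Ii; apply/mapP.
exists (Tagged (fun I => 'I_(barcode M I)) (Ordinal I_gt0)) => //.
by rewrite sE; have := Ii; rewrite -[bar_set I]/(bar_set (tag
  (Tagged (fun I => 'I_(barcode M I)) (Ordinal I_gt0)))) -vS.
Qed.

(** The intervals involved are finitely many over each point: so are the bars of
    M and N with positive multiplicity, and each bar is matched with
    finitely many others. *)
Lemma matching_codes_exist M N u :
    essential_eps_matchings eps (barcode M) (barcode N) u ->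
  exists L, [/\ has_codes L (matching_codes M N u),
    rep_iso (restrict_left L) M & rep_iso (restrict_right L) N].
Proof.
move=> [[[finl finr lel ler] close shortl shortr] ess].
set m := matching_codes M N u.
have mI p : (0 < m p)%N -> interval_subset (@code_set eps p).
  case: p => -[I|] [J|] //=.
  - move=> uIJ; have [lo hi] := close I J uIJ.
    apply/interval_of_compatible/compatible_of_essential => // sI sJ.
    by have [[]|[]] := ess I J uIJ sI sJ; [left|right].
  - by rewrite subn_gt0 => /shortl; rewrite interval_code_left.
  - by rewrite subn_gt0 => /shortr; rewrite -interval_code_left => /code_set_flip.
have fin (p : shoelace eps) : exists r : seq code,
    forall c, (0 < m c)%N -> @code_set eps c p -> c \in r.
  case: p => i.
    have [r rP] := barcode_fin M i.
    have [s sP] := choice (fun I => (finite_seqP _).1 (finl I)).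
    exists (flatten [seq (Some a, None) :: [seq (Some a, Some b) | b <- s a] | a <- r]).
    move=> [[I|] o] //= m_gt0 Ii; apply/flattenP.
    exists ((Some I, None) :: [seq (Some I, Some J) | J <- s I]).
      apply/mapP; exists I => //; apply: rP => //.
      case: o m_gt0 => [J|] /=; last by move/leq_trans; apply; apply: leq_subr.
      move=> uIJ; apply: leq_trans (lel I); apply: leq_trans uIJ _.
      exact: (leq_fsbig_term (F := u I)).
    case: o m_gt0 => [J|] /=; last by rewrite mem_head.
    move=> uIJ; rewrite inE (map_f (fun J => (Some I, Some J))) ?orbT //.
    have : [set J | u I J != 0%N] J by rewrite /= -lt0n.
    by rewrite sP.
  have [r rP] := barcode_fin N i.
  have [s sP] := choice (fun J => (finite_seqP _).1 (finr J)).
  exists (flatten [seq (None, Some J) :: [seq (Some a, Some J) | a <- s J] | J <- r]).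
  move=> [o [J|]] //= m_gt0 Ji; apply/flattenP.
  exists ((None, Some J) :: [seq (Some a, Some J) | a <- s J]).
    apply/mapP; exists J => //; apply: rP => //.
    case: o m_gt0 => [I|] /=; last by move/leq_trans; apply; apply: leq_subr.
    move=> uIJ; apply: leq_trans (ler J); apply: leq_trans uIJ _.
    exact: (leq_fsbig_term (F := u^~ J)).
  case: o m_gt0 => [I|] /=; last by rewrite mem_head.
  move=> uIJ; rewrite inE (map_f (fun I => (Some I, Some J))) ?orbT //.
  have : [set I | u I J != 0%N] I by rewrite /= -lt0n.
  by rewrite sP.
have [L dec] := @decomposes_exists K _ _ _ _ _ (fun p p0 => (mI p p0).2) fin.
exists L; split; first by split.
- have [_ decl] := decomposes_left dec.
  apply: decomposes_iso decl _; suff -> : (fun I => m (Some I, None) +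
      matched_l (pairing m) I)%N = barcode M by apply: decomposes_barcode.
  by apply/funext => I; rewrite subnK.
- have [_ decr] := decomposes_right dec.
  apply: decomposes_iso decr _; suff -> : (fun J => m (None, Some J) +
      matched_r (pairing m) J)%N = barcode N by apply: decomposes_barcode.
  by apply/funext => J; rewrite subnK.
Qed.

End Correspondence.

Theorem theorem5p10 (K : fieldType) (eps : nat) (M N : persistence_module K) :
  classes_in_bijection (@connects K eps M N) (@rep_iso K _ (shoelace eps))
    (essential_eps_matchings eps (barcode M) (barcode N)).
Proof.
pose F (L : rep K (shoelace eps)) : pair_multiset :=
  xget (fun _ _ => 0%N) [set u | exists2 m, has_codes L m & u = pairing m].
have FE L m : has_codes L m -> F L = pairing m.
  move=> Lm; apply: xget_unique; first by exists m.
  by move=> _ [m' Lm' ->]; rewrite (has_codes_unique Lm Lm').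
exists F; split=> [L [LI LM LN]|L L' [LI LM LN] [LI' LM' LN']|u uP].
- have [m Lm] := has_codes_exists LI; rewrite (FE _ _ Lm).
  exact: pairing_essential Lm LM LN.
- have [m Lm] := has_codes_exists LI; have [m' Lm'] := has_codes_exists LI'.
  rewrite (FE _ _ Lm) (FE _ _ Lm'); split=> [LL'|mm'].
    by rewrite (has_codes_unique (has_codes_iso LL' Lm) Lm').
  exact: same_pairing_iso Lm Lm' LM LN LM' LN' mm'.
- have [L [Lm LM LN]] := matching_codes_exist uP; exists L; split.
    by split=> //; apply: has_codes_decomposable Lm.
  by rewrite (FE _ _ Lm).
Qed.
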